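(* Let $m\in\mathbb N$, $b>0$, $\tau>\gamma_0$, let $\mathcal S=\{n(N)\}_{N=1}^\infty$ be an increasing sequence of positive integers, and let $(D_n)_{n\in\mathcal S}$ be positive constants (depending on $b,\tau,m$ but not on the functions below) such that $$\lim_{N\to\infty}D_{n(N)}e^{n(N)\psi(\tau)}=0.$$ For $n\in\mathcal S$ put $\sigma=\sigma_n:=n/(mb\tau)$. Then for every $\gamma>0$ there exist a constant $C=C(b,\tau,m,\gamma)$ and an integer $n_0=n_0(b,\tau,m,\gamma)$ such that for every $n\in\mathcal S$ with $n\ge n_0$ there is a finite set $\{X_1,\dots,X_\Lambda\}\subset Q^m_b$ with $\Lambda\le Cn^m$ such that $$\|f\|_{L_\infty(Q^m_b)}\le(1+\gamma)\max_{1\le j\le\Lambda}|f(X_j)|$$ for every entire function $f:\mathbb C^m\to\mathbb C$ satisfying $|f(w)|\le D_n\|f\|_{L_\infty(Q^m_b)}\exp(\sigma_n\sum_{j=1}^m|w_j|)$ for all $w\in\mathbb C^m$.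
   Context: $Q^m_b=\{x\in\mathbb R^m:\max_j|x_j|\le b\}$. $\psi(\tau):=\frac{\sqrt{1+\tau^2}}{\tau}-\log(\tau+\sqrt{1+\tau^2})$ for $\tau>0$; $\psi$ is strictly decreasing with a unique positive zero $\gamma_0=1.5088\ldots$, and $\psi(\tau)<0$ for $\tau>\gamma_0$. *)

(* Defs.v *)
From Stdlib Require Import Reals Lra List. From Stdlib Require Fin.
From Coquelicot Require Import Coquelicot.
Open Scope R_scope.

Definition psi (t : R) : R :=
  sqrt (1 + t ^ 2) / t - ln (t + sqrt (1 + t ^ 2)).

(* gamma_0 : the unique positive zero of psi (psi strictly decreasing on (0,oo)),
   defined as sup { t > 0 | psi t >= 0 }. *)
Definition gamma0 : R := real (Lub_Rbar (fun t => 0 < t /\ 0 <= psi t)).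

Fixpoint sumFin (m : nat) : (Fin.t m -> R) -> R :=
  match m return (Fin.t m -> R) -> R with
  | O => fun _ => 0
  | S k => fun g => g Fin.F1 + sumFin k (fun i => g (Fin.FS i))
  end.

Definition upd {m : nat} (w : Fin.t m -> C) (j : Fin.t m) (z : C) : Fin.t m -> C :=
  fun i => if Fin.eq_dec i j then z else w i.

Definition entire {m : nat} (f : (Fin.t m -> C) -> C) : Prop :=
  (forall w (eps : R), 0 < eps -> exists delta : R, 0 < delta /\
     forall w', (forall i, Cmod (w' i - w i) < delta) -> Cmod (f w' - f w) < eps)
  /\ (forall w j, ex_derive (K := C_AbsRing) (V := C_NormedModule)
                     (fun z : C => f (upd w j z)) (w j)).

Definition inQ {m : nat} (b : R) (x : Fin.t m -> R) : Prop :=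
  forall i, Rabs (x i) <= b.

Definition toC {m : nat} (x : Fin.t m -> R) : Fin.t m -> C := fun i => RtoC (x i).

(* ||f||_{L_oo(Q^m_b)} = sup_{x in Q^m_b} |f(x)| (f is continuous) *)
Definition supQ {m : nat} (b : R) (f : (Fin.t m -> C) -> C) : R :=
  real (Lub_Rbar (fun r => exists x, inQ b x /\ r = Cmod (f (toC x)))).

Definition maxpts {m : nat} (f : (Fin.t m -> C) -> C) (X : list (Fin.t m -> R)) : R :=
  fold_right Rmax 0 (map (fun x => Cmod (f (toC x))) X).

(* Main.v *)
Require Import Defs.
From Stdlib Require Import Reals List. From Stdlib Require Fin.
From Stdlib Require Import Lra Lia FunctionalExtensionality ClassicalEpsilon.
From Coquelicot Require Import Coquelicot.
Open Scope R_scope.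

(** Freeze all variables of [f] but one, at real values in [[-b, b]].  By Cauchy's formula on
    the boundary of the square [[-2b, 2b]^2], the resulting entire function of one variable is
    approximated on [[-b, b]] by a polynomial of degree less than [M = B n], with an error of
    order [D_n e^(4 n / tau) 2^(-B n)] times the sup norm of [f].  Since [D_n = o(e^(-n psi(tau)))],
    a large constant [B] makes this error tend to [0].

    A polynomial of degree less than [M], seen through [x = b cos t], is a trigonometric polynomial
    of degree at most [M]; it is reproduced from its values at [L = N + 2 M] equidistant nodes by
    the kernel [N^-1 conj(D_N) D_L], the [D]'s being one-sided Dirichlet kernels.  By AM-GM and
    Parseval the discrete L1 norm of that kernel is at most [1 + M / N], so [N = A M] with [A] large
    gives a norming set of [O(n)] points with constant close to [1].  Replacing one coordinate
    after the other by these points yields the product grid. *)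

(** * Complex differentiability *)

Definition Ccont (f : C -> C) (z : C) : Prop :=
  forall eps, 0 < eps -> exists d, 0 < d /\
    forall y, Cmod (y - z) < d -> Cmod (f y - f z) < eps.

(** Multiplied out and non-strict, so that no quotient appears and the point [y = z] needs no
    exclusion. *)
Definition Cdiff_at (f : C -> C) (z l : C) : Prop :=
  forall eps, 0 < eps -> exists d, 0 < d /\
    forall y, Cmod (y - z) < d ->
      Cmod (f y - f z - l * (y - z)) <= eps * Cmod (y - z).

Definition Cdiff (f : C -> C) (z : C) : Prop := exists l, Cdiff_at f z l.

Lemma ex_derive_Cdiff (f : C -> C) (z : C) :
  ex_derive (K := C_AbsRing) (V := C_NormedModule) f z -> Cdiff f z.
Proof.
  intros [l [_ H]]. exists l. intros eps He.
  (* The domination clause quantifies over limits of the filter [locally z]; it is taken at [z]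
     itself, where the required inclusion of filters is the identity. *)
  destruct (H z (fun P HP => HP) (mkposreal eps He)) as [d Hd].
  exists d. split; [apply cond_pos|]. intros y Hy.
  specialize (Hd y Hy).
  replace (f y - f z - l * (y - z))%C
    with (minus (minus (f y) (f z)) (scal (minus y z) l)) by
    (unfold minus, plus, opp, scal; simpl; unfold mult; simpl; ring).
  exact Hd.
Qed.

Lemma Cmod_minus_sym (x y : C) : Cmod (x - y) = Cmod (y - x).
Proof. rewrite <- Cmod_opp. f_equal. ring. Qed.

Lemma Cdiff_Ccont (f : C -> C) (z : C) : Cdiff f z -> Ccont f z.
Proof.
  intros [l H] eps He. destruct (H 1 Rlt_0_1) as [d [Hd HH]].
  assert (Hl := Cmod_ge_0 l).
  set (k := eps / (2 + Cmod l)).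
  assert (Hk : 0 < k) by (apply Rdiv_lt_0_compat; lra).
  exists (Rmin d k). split; [apply Rmin_glb_lt; lra|].
  intros y Hy.
  assert (Hy1 : Cmod (y - z) < d) by (eapply Rlt_le_trans; [exact Hy | apply Rmin_l]).
  assert (Hy2 : Cmod (y - z) < k) by (eapply Rlt_le_trans; [exact Hy | apply Rmin_r]).
  specialize (HH y Hy1).
  replace (f y - f z)%C with ((f y - f z - l * (y - z)) + l * (y - z))%C by ring.
  eapply Rle_lt_trans; [apply Cmod_triangle|]. rewrite Cmod_mult.
  assert (Hyz := Cmod_ge_0 (y - z)).
  apply Rle_lt_trans with ((1 + Cmod l) * Cmod (y - z)); [lra|].
  apply Rle_lt_trans with ((1 + Cmod l) * k); [apply Rmult_le_compat_l; lra|].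
  assert (E : (2 + Cmod l) * k = eps) by (unfold k; field; lra).
  nra.
Qed.

Lemma Ccont_bounded (f : C -> C) (z : C) : Ccont f z ->
  exists d, 0 < d /\ forall y, Cmod (y - z) < d -> Cmod (f y) <= Cmod (f z) + 1.
Proof.
  intros H. destruct (H 1 Rlt_0_1) as [d [Hd HH]]. exists d. split; auto.
  intros y Hy. specialize (HH y Hy).
  replace (f y) with (f y - f z + f z)%C by ring.
  eapply Rle_trans; [apply Cmod_triangle|]. lra.
Qed.

(** The remainder splits into three terms: the remainder of [f] times [g y], [f z] times the
    remainder of [g], and [lf] times the increment of [g]. The first calls for a local bound of [g],
    the last for its continuity, and [A] adds up the three coefficients. *)
Lemma Cdiff_mult (f g : C -> C) (z : C) :
  Cdiff f z -> Cdiff g z -> Cdiff (fun y => f y * g y)%C z.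
Proof.
  intros Hf Hg.
  destruct (Ccont_bounded g z (Cdiff_Ccont _ _ Hg)) as [d0 [Hd0 Hb]].
  pose proof (Cdiff_Ccont _ _ Hg) as Cg.
  destruct Hf as [lf Hf], Hg as [lg Hg].
  exists (lf * g z + f z * lg)%C. intros eps He.
  pose proof (Cmod_ge_0 (g z)) as P1. pose proof (Cmod_ge_0 (f z)) as P2.
  pose proof (Cmod_ge_0 lf) as P3.
  set (A := Cmod (g z) + 1 + Cmod (f z) + Cmod lf).
  assert (HA : 0 < A) by (unfold A; lra).
  set (e := eps / A).
  assert (Hep : 0 < e) by (apply Rdiv_lt_0_compat; lra).
  destruct (Hf e Hep) as [d1 [Hd1 H1]], (Hg e Hep) as [d2 [Hd2 H2]],
    (Cg e Hep) as [d3 [Hd3 H3]].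
  exists (Rmin (Rmin d0 d1) (Rmin d2 d3)).
  split; [repeat apply Rmin_glb_lt; lra|].
  intros y Hy.
  assert (Cmod (y - z) < d0 /\ Cmod (y - z) < d1 /\ Cmod (y - z) < d2 /\ Cmod (y - z) < d3)
    as (h0 & h1 & h2 & h3).
  { repeat split; (eapply Rlt_le_trans; [exact Hy|]);
    [ eapply Rle_trans; [apply Rmin_l | apply Rmin_l]
    | eapply Rle_trans; [apply Rmin_l | apply Rmin_r]
    | eapply Rle_trans; [apply Rmin_r | apply Rmin_l]
    | eapply Rle_trans; [apply Rmin_r | apply Rmin_r] ]. }
  specialize (Hb y h0). specialize (H1 y h1). specialize (H2 y h2). specialize (H3 y h3).
  replace (f y * g y - f z * g z - (lf * g z + f z * lg) * (y - z))%C
    with ((f y - f z - lf * (y - z)) * g y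
          + (f z * (g y - g z - lg * (y - z)) + lf * (g y - g z) * (y - z)))%C by ring.
  eapply Rle_trans; [apply Cmod_triangle|].
  eapply Rle_trans; [apply Rplus_le_compat_l, Cmod_triangle|].
  rewrite !Cmod_mult.
  pose proof (Cmod_ge_0 (y - z)) as P4.
  set (r := Cmod (y - z)) in *.
  assert (E : eps = e * A) by (unfold e; field; lra).
  rewrite E. unfold A.
  assert (Q1 : Cmod (f y - f z - lf * (y - z)) * Cmod (g y) <= e * r * (Cmod (g z) + 1)).
  { apply Rmult_le_compat; auto using Cmod_ge_0. }
  assert (Q2 : Cmod (f z) * Cmod (g y - g z - lg * (y - z)) <= Cmod (f z) * (e * r)).
  { apply Rmult_le_compat_l; auto. }
  assert (Q3 : Cmod lf * Cmod (g y - g z) * r <= Cmod lf * e * r).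
  { apply Rmult_le_compat_r; auto. apply Rmult_le_compat_l; lra. }
  lra.
Qed.

Lemma Cminus_neq_0 (z x : C) : z <> x -> (z - x)%C <> RtoC 0.
Proof.
  intros H E. apply H. replace z with (z - x + x)%C by ring. rewrite E. ring.
Qed.

(** The remainder is exactly [(y - z)^2 / ((y - x) * (z - x)^2)]. Within distance [a / 2] of [z] the
    denominator has modulus at least [a^3 / 2], which explains the radius [k]. *)
Lemma Cdiff_inv_shift (x z : C) : z <> x -> Cdiff (fun y => / (y - x))%C z.
Proof.
  intros Hz. assert (Hzx := Cminus_neq_0 z x Hz).
  set (a := Cmod (z - x)).
  assert (Ha : 0 < a) by (apply Cmod_gt_0; exact Hzx).
  exists (- / ((z - x) * (z - x)))%C. intros eps He.
  set (k := eps * (a * a * a) / 2).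
  assert (Ha3 : 0 < a * a * a) by (repeat apply Rmult_lt_0_compat; lra).
  assert (Hk : 0 < k) by (unfold k; nra).
  exists (Rmin (a / 2) k). split; [apply Rmin_glb_lt; lra|]. intros y Hy.
  assert (h1 : Cmod (y - z) < a / 2) by (eapply Rlt_le_trans; [exact Hy | apply Rmin_l]).
  assert (h2 : Cmod (y - z) < k) by (eapply Rlt_le_trans; [exact Hy | apply Rmin_r]).
  assert (Hyx : a / 2 < Cmod (y - x)).
  { assert (T := Cmod_triangle (y - x) (z - y)).
    replace (y - x + (z - y))%C with (z - x)%C in T by ring.
    rewrite (Cmod_minus_sym z y) in T. fold a in T. lra. }
  assert (Hyx0 : (y - x)%C <> 0) by (apply Cmod_gt_0; lra).
  replace (/ (y - x) - / (z - x) - - / ((z - x) * (z - x)) * (y - z))%C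
    with ((y - z) * (y - z) / ((y - x) * ((z - x) * (z - x))))%C by (field; auto).
  assert (Hp : ((y - x) * ((z - x) * (z - x)))%C <> 0) by (repeat apply Cmult_neq_0; auto).
  rewrite Cmod_div by exact Hp. rewrite !Cmod_mult. fold a.
  set (r := Cmod (y - z)) in *. set (s := Cmod (y - x)) in *.
  assert (Hr : 0 <= r) by apply Cmod_ge_0.
  apply (Rmult_le_reg_r (s * (a * a))); [apply Rmult_lt_0_compat; nra|].
  unfold Rdiv. rewrite Rmult_assoc, Rinv_l by (apply Rgt_not_eq, Rmult_lt_0_compat; nra).
  assert (Q : k <= eps * (s * (a * a))).
  { unfold k. assert (a / 2 * (a * a) <= s * (a * a)) by (apply Rmult_le_compat_r; nra).
    assert (eps * (a / 2 * (a * a)) <= eps * (s * (a * a))) by (apply Rmult_le_compat_l; lra).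
    lra. }
  rewrite Rmult_1_r.
  apply Rle_trans with (r * (eps * (s * (a * a)))); [apply Rmult_le_compat_l; lra|]. lra.
Qed.

Lemma Cdiff_ext (f g : C -> C) (z : C) : (forall y, f y = g y) -> Cdiff f z -> Cdiff g z.
Proof.
  intros E [l H]. exists l. intros eps He. destruct (H eps He) as [d [Hd HH]].
  exists d. split; auto. intros y Hy. rewrite <- !E. auto.
Qed.

Lemma Cdiff_const (c z : C) : Cdiff (fun _ => c) z.
Proof.
  exists (RtoC 0). intros eps He. exists 1. split; [lra|]. intros y _.
  replace (c - c - 0 * (y - z))%C with (RtoC 0) by ring. rewrite Cmod_0.
  pose proof (Cmod_ge_0 (y - z)). nra.
Qed.

(** Affine functions are what gets subtracted in Goursat's argument: their integrals over rectangles
    can be computed by hand. *)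
Definition Clin (u v : C) (z : C) : C := (u + v * z)%C.

Lemma Cdiff_Clin (u v z : C) : Cdiff (Clin u v) z.
Proof.
  exists v. intros eps He. exists 1. split; [lra|]. intros y _.
  replace (Clin u v y - Clin u v z - v * (y - z))%C with (RtoC 0) by (unfold Clin; ring).
  rewrite Cmod_0. pose proof (Cmod_ge_0 (y - z)). nra.
Qed.

Lemma Cdiff_plus (f g : C -> C) (z : C) :
  Cdiff f z -> Cdiff g z -> Cdiff (fun y => f y + g y)%C z.
Proof.
  intros [lf Hf] [lg Hg]. exists (lf + lg)%C. intros eps He.
  destruct (Hf (eps / 2)) as [d1 [Hd1 H1]]; [lra|].
  destruct (Hg (eps / 2)) as [d2 [Hd2 H2]]; [lra|].
  exists (Rmin d1 d2). split; [apply Rmin_glb_lt; lra|]. intros y Hy.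
  specialize (H1 y (Rlt_le_trans _ _ _ Hy (Rmin_l _ _))).
  specialize (H2 y (Rlt_le_trans _ _ _ Hy (Rmin_r _ _))).
  replace (f y + g y - (f z + g z) - (lf + lg) * (y - z))%C
    with ((f y - f z - lf * (y - z)) + (g y - g z - lg * (y - z)))%C by ring.
  eapply Rle_trans; [apply Cmod_triangle|]. lra.
Qed.

(** * Complex integrals over segments and rectangles *)

Definition CI (f : R -> C) (a b : R) : C :=
  (RInt (fun t => fst (f t)) a b, RInt (fun t => snd (f t)) a b).

Definition ex_CI (f : R -> C) (a b : R) : Prop :=
  ex_RInt (fun t => fst (f t)) a b /\ ex_RInt (fun t => snd (f t)) a b.

Lemma CI_ext (f g : R -> C) (a b : R) :
  (forall t, Rmin a b < t < Rmax a b -> f t = g t) -> CI f a b = CI g a b.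
Proof.
  intros H. unfold CI. f_equal; apply RInt_ext; intros t Ht; rewrite H; auto.
Qed.

Lemma CI_plus (f g : R -> C) (a b : R) : ex_CI f a b -> ex_CI g a b ->
  CI (fun t => f t + g t)%C a b = (CI f a b + CI g a b)%C.
Proof.
  intros [F1 F2] [G1 G2]. unfold CI, Cplus. simpl. f_equal.
  - apply (RInt_plus (V := R_CompleteNormedModule)); auto.
  - apply (RInt_plus (V := R_CompleteNormedModule)); auto.
Qed.

Lemma CI_scal (u : C) (f : R -> C) (a b : R) : ex_CI f a b ->
  CI (fun t => u * f t)%C a b = (u * CI f a b)%C.
Proof.
  intros [F1 F2]. unfold CI, Cmult. simpl.
  assert (S1 : forall (k : R) h, ex_RInt h a b -> ex_RInt (fun t => k * h t) a b)
    by (intros k h Hh; apply (ex_RInt_scal (V := R_NormedModule)); exact Hh).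
  assert (S2 : forall (k : R) h, ex_RInt h a b -> RInt (fun t => k * h t) a b = k * RInt h a b)
    by (intros k h Hh; apply (RInt_scal (V := R_CompleteNormedModule)); exact Hh).
  f_equal.
  - etransitivity; [apply (RInt_minus (V := R_CompleteNormedModule)); apply S1; auto|].
    rewrite !S2 by auto. reflexivity.
  - etransitivity; [apply (RInt_plus (V := R_CompleteNormedModule)); apply S1; auto|].
    rewrite !S2 by auto. reflexivity.
Qed.

Lemma CI_Chasles (f : R -> C) (a b c : R) : ex_CI f a b -> ex_CI f b c ->
  CI f a c = (CI f a b + CI f b c)%C.
Proof.
  intros [F1 F2] [G1 G2]. unfold CI, Cplus. simpl.
  f_equal; symmetry; apply (RInt_Chasles (V := R_CompleteNormedModule)); auto.
Qed.

Lemma Cmod_le_abs (z : C) : Cmod z <= Rabs (fst z) + Rabs (snd z).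
Proof.
  unfold Cmod. apply Rsqr_incr_0_var.
  - rewrite Rsqr_sqrt by nra. unfold Rsqr.
    pose proof (Rabs_pos (fst z)). pose proof (Rabs_pos (snd z)).
    rewrite <- (pow2_abs (fst z)), <- (pow2_abs (snd z)). nra.
  - pose proof (Rabs_pos (fst z)). pose proof (Rabs_pos (snd z)). lra.
Qed.

Lemma Cmod_ge_fst (z : C) : Rabs (fst z) <= Cmod z.
Proof. eapply Rle_trans; [apply Rmax_l | apply Rmax_Cmod]. Qed.

Lemma Cmod_ge_snd (z : C) : Rabs (snd z) <= Cmod z.
Proof. eapply Rle_trans; [apply Rmax_r | apply Rmax_Cmod]. Qed.

(** The real and imaginary parts are bounded separately. This costs a harmless factor 2, which
    reappears in all later constants. *)
Lemma CI_bound (f : R -> C) (a b K : R) : a <= b -> ex_CI f a b ->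
  (forall t, a <= t <= b -> Cmod (f t) <= K) -> Cmod (CI f a b) <= 2 * K * (b - a).
Proof.
  intros Hab [F1 F2] H. eapply Rle_trans; [apply Cmod_le_abs|]. unfold CI; simpl.
  assert (Q1 := abs_RInt_le_const _ a b K Hab F1
    (fun t Ht => Rle_trans _ _ _ (Cmod_ge_fst _) (H t Ht))).
  assert (Q2 := abs_RInt_le_const _ a b K Hab F2
    (fun t Ht => Rle_trans _ _ _ (Cmod_ge_snd _) (H t Ht))).
  lra.
Qed.

Lemma continuous_eps (f : R -> R) (t : R) :
  (forall eps, 0 < eps -> exists d, 0 < d /\
     forall s, Rabs (s - t) < d -> Rabs (f s - f t) < eps) -> continuous f t.
Proof.
  intros H. apply filterlim_locally. intros eps.
  destruct (H eps (cond_pos eps)) as [d [Hd HH]].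
  exists (mkposreal d Hd). intros s Hs. apply HH, Hs.
Qed.

Lemma ex_CI_horizontal (f : C -> C) (a b c : R) :
  (forall t, Rmin a b <= t <= Rmax a b -> Ccont f (t, c)) -> ex_CI (fun t => f (t, c)) a b.
Proof.
  intros H.
  assert (D : forall s t, Cmod ((s, c) - (t, c)) = Rabs (s - t)).
  { intros s t. replace ((s, c) - (t, c))%C with (RtoC (s - t)); [apply Cmod_R|].
    unfold RtoC, Cminus, Cplus, Copp; simpl. f_equal; ring. }
  split; apply (ex_RInt_continuous (V := R_CompleteNormedModule)); intros t Ht;
    apply continuous_eps; intros eps He; destruct (H t Ht eps He) as [d [Hd HH]];
    exists d; split; auto; intros s Hs;
    (eapply Rle_lt_trans; [| apply (HH (s, c)); rewrite D; exact Hs]).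
  - apply (Cmod_ge_fst (f (s, c) - f (t, c))%C).
  - apply (Cmod_ge_snd (f (s, c) - f (t, c))%C).
Qed.

Lemma ex_CI_vertical (f : C -> C) (a c d : R) :
  (forall t, Rmin c d <= t <= Rmax c d -> Ccont f (a, t)) -> ex_CI (fun t => f (a, t)) c d.
Proof.
  intros H.
  assert (D : forall s t, Cmod ((a, s) - (a, t)) = Rabs (s - t)).
  { intros s t. replace ((a, s) - (a, t))%C with (Ci * RtoC (s - t))%C.
    - rewrite Cmod_mult, Cmod_Ci, Cmod_R. ring.
    - unfold RtoC, Ci, Cmult, Cminus, Cplus, Copp; simpl. f_equal; ring. }
  split; apply (ex_RInt_continuous (V := R_CompleteNormedModule)); intros t Ht;
    apply continuous_eps; intros eps He; destruct (H t Ht eps He) as [e [Hd HH]];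
    exists e; split; auto; intros s Hs;
    (eapply Rle_lt_trans; [| apply (HH (a, s)); rewrite D; exact Hs]).
  - apply (Cmod_ge_fst (f (a, s) - f (a, t))%C).
  - apply (Cmod_ge_snd (f (a, s) - f (a, t))%C).
Qed.

(** The counterclockwise contour integral over the boundary of [[a, b] x [c, d]]; the factor [Ci] is
    [dz / dt] on the vertical sides. *)
Definition rectI (f : C -> C) (a b c d : R) : C :=
  (CI (fun t => f (t, c)) a b - CI (fun t => f (t, d)) a b
   + Ci * (CI (fun t => f (b, t)) c d - CI (fun t => f (a, t)) c d))%C.

Definition on_edges (P : C -> Prop) (a b c d : R) : Prop :=
  (forall t, a <= t <= b -> P (t, c) /\ P (t, d)) /\
  (forall t, c <= t <= d -> P (a, t) /\ P (b, t)).

Section RectangleIntegral.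
Variables (a b c d : R).
Hypotheses (Hab : a <= b) (Hcd : c <= d).

Lemma ex_CI_edges (f : C -> C) : on_edges (Ccont f) a b c d ->
  ex_CI (fun t => f (t, c)) a b /\ ex_CI (fun t => f (t, d)) a b /\
  ex_CI (fun t => f (a, t)) c d /\ ex_CI (fun t => f (b, t)) c d.
Proof.
  intros [H1 H2]. split; [|split; [|split]].
  1,2: apply ex_CI_horizontal; rewrite Rmin_left, Rmax_right by lra; intros t Ht; apply H1; auto.
  1,2: apply ex_CI_vertical; rewrite Rmin_left, Rmax_right by lra; intros t Ht; apply H2; auto.
Qed.

Lemma rectI_ext (f g : C -> C) :
  on_edges (fun z => f z = g z) a b c d -> rectI f a b c d = rectI g a b c d.
Proof.
  intros [H1 H2]. unfold rectI.
  repeat match goal with |- context [CI (fun t => f (t, ?y)) a b] =>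
    replace (CI (fun t => f (t, y)) a b) with (CI (fun t => g (t, y)) a b);
    [| apply CI_ext; rewrite Rmin_left, Rmax_right by lra; intros t Ht; symmetry; apply H1; lra ] end.
  repeat match goal with |- context [CI (fun t => f (?y, t)) c d] =>
    replace (CI (fun t => f (y, t)) c d) with (CI (fun t => g (y, t)) c d);
    [| apply CI_ext; rewrite Rmin_left, Rmax_right by lra; intros t Ht; symmetry; apply H2; lra ] end.
  reflexivity.
Qed.

Lemma rectI_plus (f g : C -> C) :
  on_edges (Ccont f) a b c d -> on_edges (Ccont g) a b c d ->
  rectI (fun z => f z + g z)%C a b c d = (rectI f a b c d + rectI g a b c d)%C.
Proof.
  intros F G. apply ex_CI_edges in F as (F1 & F2 & F3 & F4).
  apply ex_CI_edges in G as (G1 & G2 & G3 & G4).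
  unfold rectI. rewrite !CI_plus by auto. ring.
Qed.

Lemma rectI_scal (u : C) (f : C -> C) :
  on_edges (Ccont f) a b c d ->
  rectI (fun z => u * f z)%C a b c d = (u * rectI f a b c d)%C.
Proof.
  intros F. apply ex_CI_edges in F as (F1 & F2 & F3 & F4).
  unfold rectI. rewrite !CI_scal by auto. ring.
Qed.

Lemma rectI_bound (f : C -> C) (K : R) :
  on_edges (Ccont f) a b c d -> on_edges (fun z => Cmod (f z) <= K) a b c d ->
  Cmod (rectI f a b c d) <= 4 * K * ((b - a) + (d - c)).
Proof.
  intros F [B1 B2]. apply ex_CI_edges in F as (F1 & F2 & F3 & F4).
  assert (Q1 := CI_bound _ a b K Hab F1 (fun t Ht => proj1 (B1 t Ht))).
  assert (Q2 := CI_bound _ a b K Hab F2 (fun t Ht => proj2 (B1 t Ht))).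
  assert (Q3 := CI_bound _ c d K Hcd F3 (fun t Ht => proj1 (B2 t Ht))).
  assert (Q4 := CI_bound _ c d K Hcd F4 (fun t Ht => proj2 (B2 t Ht))).
  unfold rectI. eapply Rle_trans; [apply Cmod_triangle|].
  rewrite Cmod_mult, Cmod_Ci.
  unfold Cminus.
  eapply Rle_trans; [apply Rplus_le_compat; [apply Cmod_triangle|
    apply Rmult_le_compat_l; [lra | apply Cmod_triangle]]|].
  rewrite !Cmod_opp. lra.
Qed.

Lemma rectI_split_x (f : C -> C) (e : R) : a <= e <= b ->
  on_edges (Ccont f) a b c d ->
  rectI f a b c d = (rectI f a e c d + rectI f e b c d)%C.
Proof.
  intros He [H1 H2]. unfold rectI.
  assert (X : forall y p q, a <= p <= q -> q <= b -> (y = c \/ y = d) -> ex_CI (fun t => f (t, y)) p q).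
  { intros y p q Hp Hq [-> | ->]; apply ex_CI_horizontal; rewrite Rmin_left, Rmax_right by lra;
    intros t Ht; apply H1; lra. }
  rewrite (CI_Chasles (fun t => f (t, c)) a e b) by (apply X; auto; lra).
  rewrite (CI_Chasles (fun t => f (t, d)) a e b) by (apply X; auto; lra).
  ring.
Qed.

Lemma rectI_split_y (f : C -> C) (e : R) : c <= e <= d ->
  on_edges (Ccont f) a b c d ->
  rectI f a b c d = (rectI f a b c e + rectI f a b e d)%C.
Proof.
  intros He [H1 H2]. unfold rectI.
  assert (X : forall y p q, c <= p <= q -> q <= d -> (y = a \/ y = b) -> ex_CI (fun t => f (y, t)) p q).
  { intros y p q Hp Hq [-> | ->]; apply ex_CI_vertical; rewrite Rmin_left, Rmax_right by lra;
    intros t Ht; apply H2; lra. }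
  rewrite (CI_Chasles (fun t => f (a, t)) c e d) by (apply X; auto; lra).
  rewrite (CI_Chasles (fun t => f (b, t)) c e d) by (apply X; auto; lra).
  ring.
Qed.

End RectangleIntegral.

Lemma RInt_affine (u v a b : R) :
  RInt (fun t => u + v * t) a b = u * (b - a) + v * ((b * b - a * a) / 2).
Proof.
  apply is_RInt_unique.
  replace (u * (b - a) + v * ((b * b - a * a) / 2))
    with (minus (u * b + v * (b * b / 2)) (u * a + v * (a * a / 2)))
    by (unfold minus, plus, opp; simpl; field).
  apply (is_RInt_derive (V := R_CompleteNormedModule) (fun t => u * t + v * (t * t / 2)) (fun t => u + v * t)).
  - intros x _. auto_derive; auto. field.
  - intros x _. apply (ex_derive_continuous (V := R_NormedModule)). auto_derive. auto.
Qed.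

(** Each side is an integral of real affine functions, so the cancellation is checked explicitly,
    without any notion of primitive along a contour. *)
Lemma rectI_Clin (u v : C) (a b c d : R) : rectI (Clin u v) a b c d = (RtoC 0).
Proof.
  assert (H : forall y, CI (fun t => Clin u v (t, y)) a b =
    ((fst u - snd v * y) * (b - a) + fst v * ((b * b - a * a) / 2),
     (snd u + fst v * y) * (b - a) + snd v * ((b * b - a * a) / 2))).
  { intros y. unfold CI. rewrite <- !RInt_affine. f_equal; apply RInt_ext; intros t _;
    unfold Clin, Cplus, Cmult; simpl; ring. }
  assert (V : forall x, CI (fun t => Clin u v (x, t)) c d =
    ((fst u + fst v * x) * (d - c) + - snd v * ((d * d - c * c) / 2),
     (snd u + snd v * x) * (d - c) + fst v * ((d * d - c * c) / 2))).
  { intros x. unfold CI. rewrite <- !RInt_affine. f_equal; apply RInt_ext; intros t _;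
    unfold Clin, Cplus, Cmult; simpl; ring. }
  unfold rectI. rewrite !H, !V.
  unfold Ci, Cplus, Cminus, Copp, Cmult, RtoC; simpl. f_equal; field.
Qed.

(** * Goursat's theorem *)

Lemma nested_intervals (u v : nat -> R) :
  (forall n, u n <= v n) -> (forall n, u n <= u (S n)) -> (forall n, v (S n) <= v n) ->
  exists x, forall n, u n <= x <= v n.
Proof.
  intros Huv Hu Hv.
  assert (Mu : forall n k, u n <= u (n + k)%nat).
  { intros n k. induction k as [|k IH]; [rewrite Nat.add_0_r; lra|].
    rewrite Nat.add_succ_r. specialize (Hu (n + k)%nat). lra. }
  assert (Mv : forall n k, v (n + k)%nat <= v n).
  { intros n k. induction k as [|k IH]; [rewrite Nat.add_0_r; lra|].
    rewrite Nat.add_succ_r. specialize (Hv (n + k)%nat). lra. }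
  assert (UV : forall n k, u n <= v k).
  { intros n k. specialize (Mu n k). specialize (Mv k n). rewrite Nat.add_comm in Mv.
    specialize (Huv (n + k)%nat). lra. }
  destruct (completeness (fun r => exists n, r = u n)) as [x [Hx1 Hx2]].
  - exists (v 0%nat). intros r [n ->]. apply UV.
  - exists (u 0%nat), 0%nat. reflexivity.
  - exists x. intros n. split.
    + apply Hx1. exists n. reflexivity.
    + apply Hx2. intros r [k ->]. apply UV.
Qed.

Lemma halving_small (s eps : R) : 0 < eps -> exists n, Rabs s * (/ 2) ^ n < eps.
Proof.
  intros He. pose proof (Rabs_pos s) as Hs.
  destruct (pow_lt_1_zero (/ 2)) with (y := eps / (1 + Rabs s)) as [n Hn].
  - rewrite Rabs_pos_eq; lra.
  - apply Rdiv_lt_0_compat; lra.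
  - exists n. specialize (Hn n (le_n n)).
    assert (Hp : 0 < (/ 2) ^ n) by (apply pow_lt; lra).
    rewrite Rabs_pos_eq in Hn by lra.
    assert (E : eps = (1 + Rabs s) * (eps / (1 + Rabs s))) by (field; lra).
    rewrite E at 1. nra.
Qed.

(** A compactness principle: a property that passes from the four quarters to the whole, and holds
    for every small rectangle around any given point, holds globally. Otherwise bad quarters nest
    down to a point at which the local hypothesis is violated. *)
Lemma rectangle_bisection (P : R -> R -> R -> R -> Prop) (a b c d : R) :
  a <= b -> c <= d ->
  (forall a' b' c' d', a <= a' <= b' -> b' <= b -> c <= c' <= d' -> d' <= d ->
     let x := (a' + b') / 2 in let y := (c' + d') / 2 in
     P a' x c' y -> P x b' c' y -> P a' x y d' -> P x b' y d' -> P a' b' c' d') ->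
  (forall x y, a <= x <= b -> c <= y <= d -> exists delta, 0 < delta /\
     forall a' b' c' d', a <= a' <= x -> x <= b' <= b -> c <= c' <= y -> y <= d' <= d ->
       (b' - a') + (d' - c') < delta -> P a' b' c' d') ->
  P a b c d.
Proof.
  intros Hab Hcd Hstep Hloc. apply NNPP. intros Hbad.
  set (bad := fun r : R * R * R * R => let '(p, q, s, t) := r in ~ P p q s t).
  (* The first quarter on which [P] fails comes next. The upper right one is the default: it must be
     bad when the other three are good, by the subdivision hypothesis. *)
  set (step := fun r : R * R * R * R => let '(p, q, s, t) := r in
    let x := (p + q) / 2 in let y := (s + t) / 2 in
    if excluded_middle_informative (P p x s y) then
    if excluded_middle_informative (P x q s y) then
    if excluded_middle_informative (P p x y t) then (x, q, y, t)
    else (p, x, y, t) else (x, q, s, y) else (p, x, s, y)).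
  set (r := fun n => Nat.iter n step (a, b, c, d)).
  set (A := fun n => fst (fst (fst (r n)))). set (B := fun n => snd (fst (fst (r n)))).
  set (S' := fun n => snd (fst (r n))). set (T := fun n => snd (r n)).
  assert (Hr : forall n, a <= A n <= B n /\ B n <= b /\ c <= S' n <= T n /\ T n <= d /\
     ~ P (A n) (B n) (S' n) (T n) /\
     A n <= A (S n) /\ B (S n) <= B n /\ S' n <= S' (S n) /\ T (S n) <= T n /\
     B (S n) - A (S n) = (B n - A n) / 2 /\ T (S n) - S' (S n) = (T n - S' n) / 2).
  { intros n.
    assert (Hn : a <= A n <= B n /\ B n <= b /\ c <= S' n <= T n /\ T n <= d /\
     ~ P (A n) (B n) (S' n) (T n)).
    { induction n as [|n IH]; [unfold A, B, S', T, r; simpl; repeat split; auto; lra|].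
      unfold A, B, S', T, r in *. simpl. fold (Nat.iter n step (a, b, c, d)) in *.
      destruct (Nat.iter n step (a, b, c, d)) as [[[p q] s] t]. simpl in *.
      destruct IH as ([I1 I2] & I3 & [I4 I5] & I6 & I7).
      destruct (excluded_middle_informative (P p ((p + q) / 2) s ((s + t) / 2))) as [E1|E1];
      [destruct (excluded_middle_informative (P ((p + q) / 2) q s ((s + t) / 2))) as [E2|E2];
      [destruct (excluded_middle_informative (P p ((p + q) / 2) ((s + t) / 2) t)) as [E3|E3]|]|];
      simpl; repeat split; try lra; auto. }
    destruct Hn as ([N1 N2] & N3 & [N4 N5] & N6 & N7).
    do 5 (split; [auto|]).
    unfold A, B, S', T, r in *. simpl. fold (Nat.iter n step (a, b, c, d)) in *.
    destruct (Nat.iter n step (a, b, c, d)) as [[[p q] s] t]. simpl in *.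
    destruct (excluded_middle_informative (P p ((p + q) / 2) s ((s + t) / 2)));
    [destruct (excluded_middle_informative (P ((p + q) / 2) q s ((s + t) / 2)));
    [destruct (excluded_middle_informative (P p ((p + q) / 2) ((s + t) / 2) t))|]|];
    simpl; repeat split; lra. }
  destruct (nested_intervals A B) as [x Hx]; [apply Hr | apply Hr | apply Hr |].
  destruct (nested_intervals S' T) as [y Hy]; [apply Hr | apply Hr | apply Hr |].
  assert (Hsize : forall n, B n - A n + (T n - S' n) = (b - a + (d - c)) * (/ 2) ^ n).
  { induction n as [|n IH]; [unfold A, B, S', T, r; simpl; ring|].
    destruct (Hr n) as (_ & _ & _ & _ & _ & _ & _ & _ & _ & E1 & E2).
    rewrite E1, E2. replace ((B n - A n) / 2 + (T n - S' n) / 2)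
      with ((B n - A n + (T n - S' n)) * / 2) by field. rewrite IH. simpl. ring. }
  destruct (Hloc x y) as (delta & Hd & HP).
  - apply (Hx 0%nat).
  - apply (Hy 0%nat).
  - destruct (halving_small (b - a + (d - c)) delta Hd) as [n Hn].
    rewrite Rabs_pos_eq, <- Hsize in Hn by lra.
    destruct (Hr n) as ([N1 N2] & N3 & [N4 N5] & N6 & N7 & _).
    specialize (Hx n). specialize (Hy n).
    apply N7, HP; auto; lra.
Qed.

Lemma Cmod_pair_le (x y p q : R) :
  Cmod ((x, y) - (p, q)) <= Rabs (x - p) + Rabs (y - q).
Proof. apply Cmod_le_abs. Qed.

(** Bisection is applied to the estimate by [eps] times the squared half-perimeter. This quantity is
    additive over the four quarters, and it is what differentiability yields on small rectangles. *)
Lemma Goursat_rectangle (f : C -> C) (a b c d : R) : a <= b -> c <= d ->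
  (forall x y, a <= x <= b -> c <= y <= d -> Cdiff f (x, y)) ->
  rectI f a b c d = RtoC 0.
Proof.
  intros Hab Hcd Hf.
  assert (Hc : forall x y, a <= x <= b -> c <= y <= d -> Ccont f (x, y))
    by (intros; apply Cdiff_Ccont; auto).
  assert (He : forall eps, 0 < eps ->
    Cmod (rectI f a b c d) <= eps * ((b - a) + (d - c)) ^ 2).
  { intros eps Heps.
    apply (rectangle_bisection
      (fun a b c d => Cmod (rectI f a b c d) <= eps * ((b - a) + (d - c)) ^ 2)); auto.
    - intros a' b' c' d' Ha Hb Hc' Hd x y P1 P2 P3 P4.
      assert (Hx : a' <= x <= b') by (unfold x; lra).
      assert (Hy : c' <= y <= d') by (unfold y; lra).
      rewrite (rectI_split_x a' b' c' d' f x);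
        [| auto | split; intros; split; apply Hc; lra].
      rewrite (rectI_split_y a' x c' d' f y);
        [| auto | split; intros; split; apply Hc; lra].
      rewrite (rectI_split_y x b' c' d' f y);
        [| auto | split; intros; split; apply Hc; lra].
      eapply Rle_trans; [apply Cmod_triangle|].
      eapply Rle_trans; [apply Rplus_le_compat; apply Cmod_triangle|].
      eapply Rle_trans; [apply Rplus_le_compat; apply Rplus_le_compat; eassumption|].
      (* Each quarter has half the half-perimeter, hence a quarter of its square. *)
      apply Req_le. unfold x, y. field.
    - intros x y Hx Hy. destruct (Hf x y Hx Hy) as [l Hl].
      (* The 4 compensates the constant in [rectI_bound]. *)
      destruct (Hl (eps / 4)) as (delta & Hdelta & HH); [lra|].
      exists delta. split; auto.
      intros a' b' c' d' Ha Hb Hc' Hd Hs. set (s := b' - a' + (d' - c')) in *.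
      (* [g] is [f] minus its first-order expansion at [(x, y)]. It has the same integral as [f],
         and modulus at most [eps / 4 * s] on the rectangle. *)
      set (u := (f (x, y) - l * (x, y))%C).
      set (g := fun z => (f z + Clin (- u) (- l) z)%C).
      assert (Hg : forall p q, a' <= p <= b' -> c' <= q <= d' ->
        Ccont g (p, q) /\ Cmod (g (p, q)) <= eps / 4 * s).
      { intros p q Hp Hq. split.
        - apply Cdiff_Ccont. apply Cdiff_plus; [apply Hf; lra | apply Cdiff_Clin].
        - assert (Hpq : Cmod ((p, q) - (x, y)) <= s).
          { eapply Rle_trans; [apply Cmod_pair_le|].
            assert (Rabs (p - x) <= b' - a') by (apply Rabs_le; lra).
            assert (Rabs (q - y) <= d' - c') by (apply Rabs_le; lra). unfold s; lra. }
          replace (g (p, q)) with (f (p, q) - f (x, y) - l * ((p, q) - (x, y)))%C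
            by (unfold g, u, Clin; ring).
          eapply Rle_trans; [apply HH; lra|]. apply Rmult_le_compat_l; lra. }
      rewrite (rectI_ext a' b' c' d' ltac:(lra) ltac:(lra) f (fun z => g z + Clin u l z)%C)
        by (split; intros; unfold g, Clin; split; ring).
      rewrite rectI_plus, rectI_Clin; try lra;
        [| split; intros; split; apply Hg; lra
         | split; intros; split; apply Cdiff_Ccont, Cdiff_Clin].
      rewrite Cplus_0_r.
      eapply Rle_trans; [apply (rectI_bound a' b' c' d' ltac:(lra) ltac:(lra) g (eps / 4 * s));
        split; intros; split; apply Hg; lra|].
      fold s. apply Req_le. field. }
  apply Cmod_eq_0. apply Rle_antisym; [|apply Cmod_ge_0].
  apply le_epsilon. intros e Hepos.
  set (s := ((b - a) + (d - c)) ^ 2) in *.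
  assert (Hs : 0 <= s) by apply pow2_ge_0.
  (* Dividing by [1 + s] rather than [s] covers a rectangle reduced to a point. *)
  eapply Rle_trans; [apply (He (e / (1 + s)))|].
  - apply Rdiv_lt_0_compat; lra.
  - assert (E : e = (e / (1 + s)) * (1 + s)) by (field; lra).
    assert (0 < e / (1 + s)) by (apply Rdiv_lt_0_compat; lra).
    rewrite E at 2. nra.
Qed.

(** * Cauchy's formula and polynomial approximation *)

(** The contribution of one side of a square to the winding integral: a quarter of [2 * PI]. *)
Lemma RInt_atan (s r : R) : 0 < r ->
  RInt (fun t => r / ((t - s) ^ 2 + r ^ 2)) (s - r) (s + r) = PI / 2.
Proof.
  intros Hr. apply is_RInt_unique.
  assert (Hpos : forall x, 0 < (x - s) ^ 2 + r ^ 2)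
    by (intros x; pose proof (pow2_ge_0 (x - s)); assert (0 < r ^ 2) by (apply pow_lt; lra); lra).
  replace (PI / 2) with (minus (atan ((s + r - s) / r)) (atan ((s - r - s) / r))).
  - apply (is_RInt_derive (V := R_CompleteNormedModule) (fun t => atan ((t - s) / r))
      (fun t => r / ((t - s) ^ 2 + r ^ 2))).
    + intros x _. specialize (Hpos x). auto_derive; [auto|].
      field. repeat split; try lra; simpl in Hpos; try nra.
    + intros x _. specialize (Hpos x). apply (ex_derive_continuous (V := R_NormedModule)). auto_derive. lra.
  - replace ((s + r - s) / r) with 1 by (field; lra).
    replace ((s - r - s) / r) with (- (1)) by (field; lra).
    rewrite atan_opp, atan_1. unfold minus, plus, opp; simpl. field.
Qed.

Lemma rectI_inv_square (x r : R) : 0 < r ->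
  rectI (fun z => / (z - RtoC x))%C (x - r) (x + r) (- r) r = (0, 2 * PI).
Proof.
  intros Hr.
  assert (E1 := RInt_atan x r Hr). assert (E2 := RInt_atan 0 r Hr).
  replace (0 - r) with (- r) in E2 by ring. replace (0 + r) with r in E2 by ring.
  (* [R1] and [R2] are never evaluated: each occurs on two opposite sides and cancels. *)
  set (R1 := RInt (fun t => (t - x) / ((t - x) ^ 2 + r ^ 2)) (x - r) (x + r)).
  set (R2 := RInt (fun t => - t / (t ^ 2 + r ^ 2)) (- r) r).
  assert (Ex : forall (f h : R -> R) a b, (forall t, f t = h t) -> RInt f a b = RInt h a b)
    by (intros; apply RInt_ext; auto).
  assert (Op : forall (f : R -> R) a b, RInt f a b = PI / 2 -> ex_RInt f a b ->
    RInt (fun t => - f t) a b = - (PI / 2)).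
  { intros f a b Hf Hex. rewrite <- Hf. apply (RInt_opp (V := R_CompleteNormedModule)). auto. }
  assert (X : forall s a b, ex_RInt (fun t => r / ((t - s) ^ 2 + r ^ 2)) a b).
  { intros s a b. apply (ex_RInt_continuous (V := R_CompleteNormedModule)). intros t _.
    apply (ex_derive_continuous (V := R_NormedModule)). auto_derive.
    assert (0 < r * r) by nra. pose proof (pow2_ge_0 (t - s)). simpl in *. nra. }
  assert (B1 : CI (fun t => / ((t, (- r)%R) - RtoC x))%C (x - r) (x + r) = (R1, PI / 2)).
  { unfold CI, R1. rewrite <- E1. f_equal; apply Ex; intros t; simpl; f_equal; ring. }
  assert (B2 : CI (fun t => / ((t, r) - RtoC x))%C (x - r) (x + r) = (R1, - (PI / 2))).
  { unfold CI, R1. rewrite <- (Op _ _ _ E1 (X x _ _)). f_equal; apply Ex; intros t; simpl.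
    - f_equal; ring.
    - rewrite <- Rdiv_opp_l. f_equal; ring. }
  assert (B3 : CI (fun t => / (((x + r)%R, t) - RtoC x))%C (- r) r = (PI / 2, R2)).
  { unfold CI, R2. rewrite <- E2. f_equal; apply Ex; intros t; simpl; f_equal; ring. }
  assert (B4 : CI (fun t => / (((x - r)%R, t) - RtoC x))%C (- r) r = (- (PI / 2), R2)).
  { unfold CI, R2. rewrite <- (Op _ _ _ E2 (X 0 _ _)). f_equal; apply Ex; intros t; simpl.
    - rewrite <- Rdiv_opp_l. f_equal; ring.
    - f_equal; ring. }
  unfold rectI. rewrite B1, B2, B3, B4.
  unfold Ci, Cplus, Cminus, Copp, Cmult, RtoC; simpl. f_equal; field.
Qed.

Lemma pair_neq_RtoC (s t x : R) : s <> x \/ t <> 0 -> (s, t) <> RtoC x.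
Proof. intros H E. unfold RtoC in E. injection E. intros. destruct H; auto. Qed.

(** Goursat's theorem shrinks the square to an arbitrarily small one around [x], on which [g] is
    nearly the constant [g (RtoC x)]; the integral of [1 / (z - x)] there is [2 i PI]. *)
Lemma Cauchy_square (g : C -> C) (b rho x : R) :
  (forall z, Cdiff g z) -> b < rho -> Rabs x <= b ->
  rectI (fun z => g z * / (z - RtoC x))%C (- rho) rho (- rho) rho = ((0, (2 * PI)%R) * g (RtoC x))%C.
Proof.
  intros Hg Hb Hx. apply Rabs_le_between in Hx.
  set (k := fun z => (g z * / (z - RtoC x))%C).
  assert (Hk : forall s t, s <> x \/ t <> 0 -> Cdiff k (s, t)).
  { intros s t Hst. apply Cdiff_mult; auto. apply Cdiff_inv_shift, pair_neq_RtoC, Hst. }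
  assert (Hc : forall s t, s <> x \/ t <> 0 -> Ccont k (s, t))
    by (intros; apply Cdiff_Ccont; auto).
  (* The strips below and above the small square and the two pieces beside it all avoid [x], so
     their integrals vanish. *)
  assert (Hr : forall r, 0 < r <= rho - b ->
    rectI k (- rho) rho (- rho) rho = rectI k (x - r) (x + r) (- r) r).
  { intros r Hr.
    rewrite (rectI_split_y (- rho) rho (- rho) rho k (- r)); [|lra|
      split; intros t Ht; split; apply Hc; lra].
    rewrite (rectI_split_y (- rho) rho (- r) rho k r); [|lra|
      split; intros t Ht; split; apply Hc; lra].
    rewrite (rectI_split_x (- rho) rho (- r) r k (x - r)); [|lra|
      split; intros t Ht; split; apply Hc; lra].
    rewrite (rectI_split_x (x - r) rho (- r) r k (x + r)); [|lra|
      split; intros t Ht; split; apply Hc; lra].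
    rewrite (Goursat_rectangle k (- rho) rho (- rho) (- r)), (Goursat_rectangle k (- rho) rho r rho),
      (Goursat_rectangle k (- rho) (x - r) (- r) r), (Goursat_rectangle k (x + r) rho (- r) r);
      try lra; try (intros; apply Hk; lra).
    ring. }
  assert (Hd : Cmod (rectI k (- rho) rho (- rho) rho - (0, (2 * PI)%R) * g (RtoC x)) <= 0).
  { apply le_epsilon. intros e He.
    (* On the small boundary [h] is at most [e / 16 / r]. The half-perimeter is [4 * r], so
       [rectI_bound] returns [4 * (e / 16 / r) * (4 * r) = e]. *)
    destruct (Cdiff_Ccont _ _ (Hg (RtoC x)) (e / 16)) as (d & Hd & HH); [lra|].
    set (r := Rmin (d / 4) (rho - b)).
    assert (Hr0 : 0 < r) by (apply Rmin_glb_lt; lra).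
    assert (Hr1 : r <= d / 4) by apply Rmin_l.
    assert (Hr2 : r <= rho - b) by apply Rmin_r.
    rewrite (Hr r) by lra. rewrite <- (rectI_inv_square x r Hr0).
    set (h := fun z => ((g z + - g (RtoC x)) * / (z - RtoC x))%C).
    assert (Hi : forall s t, s <> x \/ t <> 0 -> Ccont (fun z => / (z - RtoC x))%C (s, t))
      by (intros; apply Cdiff_Ccont, Cdiff_inv_shift, pair_neq_RtoC; auto).
    assert (Hh : forall s t, s <> x \/ t <> 0 -> Ccont h (s, t)).
    { intros s t Hst. apply Cdiff_Ccont. apply Cdiff_mult.
      - apply Cdiff_plus; [auto | apply Cdiff_const].
      - apply Cdiff_inv_shift, pair_neq_RtoC, Hst. }
    rewrite (rectI_ext (x - r) (x + r) (- r) r ltac:(lra) ltac:(lra) k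
      (fun z => h z + g (RtoC x) * / (z - RtoC x))%C)
      by (split; intros t Ht; unfold k, h; split; ring).
    rewrite (rectI_plus (x - r) (x + r) (- r) r ltac:(lra) ltac:(lra) h
      (fun z => g (RtoC x) * / (z - RtoC x))%C).
    2: split; intros t Ht; split; apply Hh; lra.
    2: split; intros t Ht; split; apply Cdiff_Ccont, Cdiff_mult; try apply Cdiff_const;
       apply Cdiff_inv_shift, pair_neq_RtoC; lra.
    rewrite rectI_scal; [|lra|lra|split; intros t Ht; split; apply Hi; lra].
    match goal with |- Cmod (?A + ?B * ?D - ?D * ?B)%C <= _ =>
      replace (A + B * D - D * B)%C with A by ring end.
    rewrite Rplus_0_l.
    eapply Rle_trans; [apply (rectI_bound (x - r) (x + r) (- r) r ltac:(lra) ltac:(lra) h (e / 16 / r))|].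
    - split; intros t Ht; split; apply Hh; lra.
    - assert (Bd : forall s t, Rabs (s - x) <= r -> Rabs t <= r ->
        r <= Rabs (s - x) \/ r <= Rabs t -> Cmod (h (s, t)) <= e / 16 / r).
      { intros s t Hs Ht Hor.
        assert (Hlow : r <= Cmod ((s, t) - RtoC x)).
        { pose proof (Cmod_ge_fst ((s, t) - RtoC x)%C) as Q1.
          pose proof (Cmod_ge_snd ((s, t) - RtoC x)%C) as Q2. simpl in Q1, Q2.
          replace (s + - x) with (s - x) in Q1 by ring.
          replace (t + - 0) with t in Q2 by ring. destruct Hor; lra. }
        assert (Hup : Cmod ((s, t) - RtoC x) < d).
        { eapply Rle_lt_trans; [apply Cmod_pair_le|]. rewrite Rminus_0_r. lra. }
        unfold h. rewrite Cmod_mult, Cmod_inv by (apply Cmod_gt_0; lra).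
        apply Rmult_le_compat; [apply Cmod_ge_0 | left; apply Rinv_0_lt_compat; lra | |
          apply Rinv_le_contravar; lra].
        left. apply HH, Hup. }
      split; intros t Ht; split; apply Bd; try (apply Rabs_le; lra).
      + right. rewrite Rabs_Ropp, Rabs_pos_eq; lra.
      + right. rewrite Rabs_pos_eq; lra.
      + left. replace (x - r - x) with (- r) by ring. rewrite Rabs_Ropp, Rabs_pos_eq; lra.
      + left. replace (x + r - x) with r by ring. rewrite Rabs_pos_eq; lra.
    - apply Req_le. field. lra. }
  assert (Z : (rectI k (- rho) rho (- rho) rho - (0, (2 * PI)%R) * g (RtoC x))%C = RtoC 0).
  { apply Cmod_eq_0. apply Rle_antisym; [exact Hd | apply Cmod_ge_0]. }
  replace (rectI k (- rho) rho (- rho) rho) with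
    (rectI k (- rho) rho (- rho) rho - (0, (2 * PI)%R) * g (RtoC x) + (0, (2 * PI)%R) * g (RtoC x))%C by ring.
  rewrite Z. ring.
Qed.

Fixpoint Csum (n : nat) (u : nat -> C) : C :=
  match n with O => RtoC 0 | S k => (Csum k u + u k)%C end.

(** Expanding [1 / (z - x)] in Cauchy's formula as a finite geometric sum in [x / z] gives a Taylor
    polynomial; the remainder carries [(x / z)^M], at most [2^(-M)] since [|z| >= 2 b] on the
    contour. The 32 is the 4 of [rectI_bound] times the half-perimeter [8 b], over the distance [b]
    from the contour to [x]. *)
Lemma Cauchy_Taylor (g : C -> C) (b G : R) (M : nat) : 0 < b ->
  (forall z, Cdiff g z) -> on_edges (fun z => Cmod (g z) <= G) (- (2 * b)) (2 * b) (- (2 * b)) (2 * b) ->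
  exists c : nat -> C, forall x, Rabs x <= b ->
    Cmod (g (RtoC x) - Csum M (fun k => c k * RtoC x ^ k)%C) <= 32 * G * (/ 2) ^ M.
Proof.
  intros Hb Hg HG. set (rho := 2 * b) in *.
  set (w := (0, 2 * PI) : C).
  assert (Hw : w <> RtoC 0).
  { unfold w, RtoC. intros E. injection E. pose proof PI_RGT_0. lra. }
  (* The subtraction of [RtoC 0] is kept so that [Cdiff_inv_shift] applies. *)
  set (q := fun k z => (g z * / (z - RtoC 0) ^ (S k))%C).
  exists (fun k => / w * rectI (q k) (- rho) rho (- rho) rho)%C.
  intros x Hx. pose proof (proj1 (Rabs_le_between x b) Hx) as Hx'.
  assert (Dinv : forall k z, z <> RtoC 0 -> Cdiff (fun z => / (z - RtoC 0) ^ k)%C z).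
  { intros k z Hz. induction k as [|k IH].
    - apply Cdiff_ext with (fun _ => RtoC 1); [|apply Cdiff_const].
      intros y. simpl. field.
    - apply Cdiff_ext with (fun z => / (z - RtoC 0) * / (z - RtoC 0) ^ k)%C.
      + intros y. rewrite Cpow_S. symmetry.
        (* The identity is required at every point; at the origin both sides are [RtoC 0], because
           the inverse of zero is zero. *)
        destruct (Ceq_dec (y - RtoC 0) (RtoC 0)) as [E|E].
        * rewrite E. rewrite Cmult_0_l. unfold Cinv; simpl.
          unfold Cmult; simpl. f_equal; unfold Rdiv; ring.
        * set (p := (y - RtoC 0)%C) in *. clearbody p.
          assert ((p ^ k)%C <> RtoC 0) by (apply Cpow_nz; auto).
          set (pk := (p ^ k)%C) in *. clearbody pk. field. auto.
      + apply Cdiff_mult; auto. apply Cdiff_inv_shift; auto. }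
  (* The integrand left after [k] terms; [Rec] peels off one more through
     [1 / (z - x) = 1 / z + x / (z * (z - x))]. *)
  set (rem := fun k z => (RtoC x ^ k * (g z * (/ (z - RtoC 0) ^ k * / (z - RtoC x))))%C).
  assert (Edge : forall (P : C -> Prop),
    (forall s t, Rabs s <= rho -> Rabs t <= rho -> Rabs s = rho \/ Rabs t = rho -> P (s, t)) ->
    on_edges P (- rho) rho (- rho) rho).
  { intros P HP. split; intros t Ht; split; apply HP;
    try (apply Rabs_le; unfold rho in *; lra);
    try (left; rewrite ?Rabs_Ropp; apply Rabs_pos_eq; unfold rho; lra);
    right; rewrite ?Rabs_Ropp; apply Rabs_pos_eq; unfold rho; lra. }
  assert (Ne : forall s t y, Rabs y <= b -> Rabs s = rho \/ Rabs t = rho -> (s, t) <> RtoC y).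
  { intros s t y Hy Hst E. unfold RtoC in E. injection E. intros -> ->.
    rewrite Rabs_R0 in Hst. unfold rho in Hst. lra. }
  assert (R0b : Rabs 0 <= b) by (rewrite Rabs_R0; lra).
  assert (Dq : forall k, on_edges (Ccont (q k)) (- rho) rho (- rho) rho).
  { intros k. apply Edge. intros s t _ _ H. apply Cdiff_Ccont. apply Cdiff_mult; auto. }
  assert (Drem : forall k, on_edges (Ccont (rem k)) (- rho) rho (- rho) rho).
  { intros k. apply Edge. intros s t _ _ H. apply Cdiff_Ccont.
    apply Cdiff_mult; [apply Cdiff_const|]. apply Cdiff_mult; auto. apply Cdiff_mult; auto.
    apply Cdiff_inv_shift; auto. }
  assert (Nz : forall s t y, Rabs y <= b -> Rabs s = rho \/ Rabs t = rho ->
    ((s, t) - RtoC y)%C <> RtoC 0).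
  { intros s t y Hy H. apply Cminus_neq_0, Ne; auto. }
  assert (Hrho : - rho <= rho) by (unfold rho; lra).
  assert (Rec : forall k, rectI (rem k) (- rho) rho (- rho) rho =
    (RtoC x ^ k * rectI (q k) (- rho) rho (- rho) rho + rectI (rem (S k)) (- rho) rho (- rho) rho)%C).
  { intros k. rewrite <- rectI_scal by auto. rewrite <- rectI_plus; auto.
    - apply rectI_ext; auto. apply Edge. intros s t _ _ H. unfold rem, q.
      rewrite !Cpow_S.
      assert (N0 := Nz s t 0 R0b H). assert (Nx := Nz s t x Hx H).
      assert (Np : (((s, t) - RtoC 0) ^ k)%C <> RtoC 0) by (apply Cpow_nz; auto).
      set (p := (((s, t) - RtoC 0) ^ k)%C) in *.
      set (z := (s, t) : C) in *.
      replace (z - RtoC 0)%C with z in * by ring.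
      field. auto.
    - apply Edge. intros s t _ _ H. apply Cdiff_Ccont. apply Cdiff_mult; [apply Cdiff_const|].
      apply Cdiff_mult; auto. }
  assert (Sum : forall k, rectI (rem 0%nat) (- rho) rho (- rho) rho =
    (w * Csum k (fun k => / w * rectI (q k) (- rho) rho (- rho) rho * RtoC x ^ k)
     + rectI (rem k) (- rho) rho (- rho) rho)%C).
  { induction k as [|k IH]; [simpl; ring|]. rewrite IH, (Rec k). simpl. field. auto. }
  assert (C0 : rectI (rem 0%nat) (- rho) rho (- rho) rho = (w * g (RtoC x))%C).
  { unfold w. rewrite <- (Cauchy_square g b rho x); auto; [|unfold rho; lra].
    apply rectI_ext; auto. apply Edge. intros s t _ _ H. unfold rem. simpl.
    assert (Nx := Nz s t x Hx H). field. auto. }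
  specialize (Sum M). rewrite C0 in Sum.
  match goal with |- Cmod (?A - ?B) <= _ =>
    replace (A - B)%C with (rectI (rem M) (- rho) rho (- rho) rho / w)%C end.
  2: { match type of Sum with (w * ?A = w * ?B + ?D)%C =>
         replace D with (w * A - w * B)%C by (rewrite Sum; ring) end. field. auto. }
  rewrite Cmod_div by auto.
  assert (G0 : 0 <= G).
  { destruct HG as [H1 _]. eapply Rle_trans; [apply Cmod_ge_0|]. apply (proj1 (H1 0 ltac:(unfold rho; lra))). }
  (* The division by [2 * PI] is simply dropped from the bound. *)
  assert (Hw1 : 1 <= Cmod w).
  { eapply Rle_trans; [|apply Cmod_ge_snd]. unfold w; simpl. pose proof PI2_1.
    rewrite Rabs_pos_eq; lra. }
  assert (Bd : Cmod (rectI (rem M) (- rho) rho (- rho) rho) <=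
     4 * ((/ 2) ^ M * (G * / b)) * (rho - - rho + (rho - - rho))).
  { apply rectI_bound; auto.
    assert (H1 : on_edges (fun z => rho <= Cmod z /\ b <= Cmod (z - RtoC x)) (- rho) rho (- rho) rho).
    { apply Edge. intros s t _ _ H.
      assert (rho <= Cmod (s, t)).
      { destruct H as [<- | <-]; [apply (Cmod_ge_fst (s, t)) | apply (Cmod_ge_snd (s, t))]. }
      split; auto. pose proof (Cmod_triangle ((s, t) - RtoC x) (RtoC x)) as T.
      change (s, t) with ((s, t) : C) in *. set (z := (s, t) : C) in *.
      replace (z - RtoC x + RtoC x)%C with z in T by ring.
      rewrite Cmod_R in T. unfold rho in *. lra. }
    assert (H2 : forall z, Cmod (g z) <= G -> rho <= Cmod z /\ b <= Cmod (z - RtoC x) ->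
      Cmod (rem M z) <= (/ 2) ^ M * (G * / b)).
    { intros z Z1 [Z2 Z3]. unfold rem.
      replace (z - RtoC 0)%C with z by ring.
      assert (z <> RtoC 0) by (apply Cmod_gt_0; unfold rho in *; lra).
      assert ((z - RtoC x)%C <> RtoC 0) by (apply Cmod_gt_0; lra).
      rewrite !Cmod_mult, !Cmod_inv, !Cmod_pow, Cmod_R by (auto using Cpow_nz).
      set (u := Cmod z) in *. set (v := Cmod (z - RtoC x)) in *.
      assert (Hu : 0 < u) by (unfold rho in *; lra).
      replace (Rabs x ^ M * (Cmod (g z) * (/ u ^ M * / v)))
        with ((Rabs x * / u) ^ M * (Cmod (g z) * / v))
        by (rewrite Rpow_mult_distr, pow_inv; ring).
      apply Rmult_le_compat.
      - apply pow_le. apply Rmult_le_pos; [apply Rabs_pos | left; apply Rinv_0_lt_compat; lra].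
      - apply Rmult_le_pos; [apply Cmod_ge_0 | left; apply Rinv_0_lt_compat; lra].
      - apply pow_incr. split.
        + apply Rmult_le_pos; [apply Rabs_pos | left; apply Rinv_0_lt_compat; lra].
        + apply (Rmult_le_reg_r u); [lra|]. rewrite Rmult_assoc, Rinv_l by lra. unfold rho in *. lra.
      - apply Rmult_le_compat; auto; [apply Cmod_ge_0 | left; apply Rinv_0_lt_compat; lra |].
        apply Rinv_le_contravar; lra. }
    destruct HG as [A1 A2], H1 as [B1 B2].
    split; intros t Ht; split; apply H2; try apply A1; try apply A2; try apply B1; try apply B2; auto. }
  apply (Rmult_le_reg_r (Cmod w)); [lra|]. unfold Rdiv. rewrite Rmult_assoc, Rinv_l by lra.
  rewrite Rmult_1_r. eapply Rle_trans; [exact Bd|].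
  replace (4 * ((/ 2) ^ M * (G * / b)) * (rho - - rho + (rho - - rho)))
    with (32 * G * (/ 2) ^ M) by (unfold rho; field; lra).
  assert (0 <= G * (/ 2) ^ M) by (apply Rmult_le_pos; auto; apply pow_le; lra). nra.
Qed.

(** * Norming sets for polynomials *)

Lemma Csum_ext (n : nat) (u v : nat -> C) :
  (forall k, (k < n)%nat -> u k = v k) -> Csum n u = Csum n v.
Proof.
  induction n as [|n IH]; intros H; simpl; auto. rewrite IH, H by auto. reflexivity.
Qed.

Lemma Csum_plus (n : nat) (u v : nat -> C) :
  Csum n (fun k => u k + v k)%C = (Csum n u + Csum n v)%C.
Proof. induction n as [|n IH]; simpl; [ring | rewrite IH; ring]. Qed.

Lemma Csum_scal (n : nat) (a : C) (u : nat -> C) :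
  Csum n (fun k => a * u k)%C = (a * Csum n u)%C.
Proof. induction n as [|n IH]; simpl; [ring | rewrite IH; ring]. Qed.

Lemma Csum_const (n : nat) (a : C) : Csum n (fun _ => a) = (RtoC (INR n) * a)%C.
Proof.
  induction n as [|n IH]; [simpl; ring|]. cbn [Csum]. rewrite IH, S_INR, RtoC_plus. ring.
Qed.

Lemma Csum_exchange (n p : nat) (u : nat -> nat -> C) :
  Csum n (fun i => Csum p (u i)) = Csum p (fun j => Csum n (fun i => u i j)).
Proof.
  induction n as [|n IH]; simpl.
  - symmetry. rewrite Csum_const. ring.
  - rewrite IH, <- Csum_plus. reflexivity.
Qed.

Lemma Csum_delta (n k : nat) (u : nat -> C) : (k < n)%nat ->
  Csum n (fun i => if Nat.eqb k i then u i else RtoC 0) = u k.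
Proof.
  induction n as [|n IH]; intros H; [lia|]. simpl.
  destruct (Nat.eqb_spec k n) as [E|E].
  - subst. rewrite (Csum_ext n _ (fun _ => RtoC 0)); [rewrite Csum_const; ring|].
    intros i Hi. destruct (Nat.eqb_spec n i); auto. lia.
  - rewrite IH by lia. ring.
Qed.

Lemma Csum_mult (n p : nat) (u v : nat -> C) :
  (Csum n u * Csum p v)%C = Csum n (fun i => Csum p (fun j => u i * v j)%C).
Proof.
  rewrite Cmult_comm, <- Csum_scal. apply Csum_ext. intros i _. rewrite Csum_scal. ring.
Qed.

Lemma Cconj_Csum (n : nat) (u : nat -> C) :
  Cconj (Csum n u) = Csum n (fun k => Cconj (u k)).
Proof.
  induction n as [|n IH]; simpl.
  - unfold Cconj, RtoC; simpl. f_equal. ring.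
  - rewrite Cplus_conj, IH. reflexivity.
Qed.

Fixpoint Rsum (n : nat) (u : nat -> R) : R :=
  match n with O => 0 | S k => Rsum k u + u k end.

Lemma Cmod_Csum (n : nat) (u : nat -> C) : Cmod (Csum n u) <= Rsum n (fun k => Cmod (u k)).
Proof.
  induction n as [|n IH]; simpl; [rewrite Cmod_0; lra|].
  eapply Rle_trans; [apply Cmod_triangle|]. lra.
Qed.

Lemma Rsum_le (n : nat) (u v : nat -> R) :
  (forall k, (k < n)%nat -> u k <= v k) -> Rsum n u <= Rsum n v.
Proof.
  induction n as [|n IH]; intros H; simpl; [lra|].
  apply Rplus_le_compat; auto.
Qed.

Lemma Rsum_lin (n : nat) (a : R) (u v : nat -> R) :
  Rsum n (fun k => a * (u k + v k)) = a * (Rsum n u + Rsum n v).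
Proof. induction n as [|n IH]; simpl; [ring | rewrite IH; ring]. Qed.

Lemma RtoC_Rsum (n : nat) (u : nat -> R) : RtoC (Rsum n u) = Csum n (fun k => RtoC (u k)).
Proof. induction n as [|n IH]; simpl; auto. rewrite RtoC_plus, IH. reflexivity. Qed.

(** * Roots of unity and Dirichlet kernels *)

Definition cis (t : R) : C := (cos t, sin t).

Lemma cis_plus (s t : R) : cis (s + t) = (cis s * cis t)%C.
Proof. unfold cis, Cmult; simpl. rewrite cos_plus, sin_plus. f_equal; ring. Qed.

Lemma cis_0 : cis 0 = RtoC 1.
Proof. unfold cis. rewrite cos_0, sin_0. reflexivity. Qed.

Lemma cis_conj (t : R) : Cconj (cis t) = cis (- t).
Proof. unfold cis, Cconj; simpl. rewrite cos_neg, sin_neg. reflexivity. Qed.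

Lemma Cmod_cis (t : R) : Cmod (cis t) = 1.
Proof.
  unfold Cmod, cis; simpl. transitivity (sqrt 1); [f_equal | apply sqrt_1].
  pose proof (sin2_cos2 t) as H. unfold Rsqr in H. lra.
Qed.

Lemma cis_2PI (n : nat) : cis (INR n * (2 * PI)) = RtoC 1.
Proof.
  induction n as [|n IH].
  - simpl. rewrite Rmult_0_l. apply cis_0.
  - rewrite S_INR, Rmult_plus_distr_r, cis_plus, IH, Rmult_1_l.
    unfold cis. rewrite cos_2PI, sin_2PI. unfold Cmult, RtoC; simpl. f_equal; ring.
Qed.

Lemma cis_mult (n : nat) (t : R) : cis (INR n * t) = (cis t ^ n)%C.
Proof.
  induction n as [|n IH].
  - simpl. rewrite Rmult_0_l. apply cis_0.
  - rewrite S_INR, Rmult_plus_distr_r, cis_plus, IH, Rmult_1_l, Cpow_S. ring.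
Qed.

(** Since [1 - cos t = 2 sin(t / 2)^2], equality would put a zero of the sine strictly between 0 and
    [PI], up to sign. *)
Lemma cis_neq_1 (t : R) : - (2 * PI) < t < 2 * PI -> t <> 0 -> cis t <> RtoC 1.
Proof.
  intros Ht Hn E. unfold cis, RtoC in E. injection E. intros _ Hc.
  replace t with (2 * (t / 2)) in Hc by field. rewrite cos_2a_sin in Hc.
  assert (Hs : sin (t / 2) = 0) by (apply Rsqr_0_uniq; unfold Rsqr; lra).
  destruct (Rtotal_order t 0) as [H|[H|H]]; [|lra|].
  - assert (0 < sin (- (t / 2))) by (apply sin_gt_0; lra). rewrite sin_neg in *. lra.
  - assert (0 < sin (t / 2)) by (apply sin_gt_0; lra). lra.
Qed.

Lemma Csum_geometric (n : nat) (q : C) :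
  ((q - RtoC 1) * Csum n (fun j => q ^ j) = q ^ n - RtoC 1)%C.
Proof.
  induction n as [|n IH]; [simpl; ring|].
  cbn [Csum]. rewrite Cmult_plus_distr_l, IH, Cpow_S. ring.
Qed.

Definition node (L j : nat) : R := INR j * (2 * PI / INR L).

(** For distinct indices this is a full geometric sum whose ratio is an [L]-th root of unity,
    different from 1 because [|k - i| < L]. *)
Lemma cis_orthogonality (L k i : nat) : (k < L)%nat -> (i < L)%nat ->
  Csum L (fun j => cis ((INR k - INR i) * node L j)) =
  if Nat.eqb k i then RtoC (INR L) else RtoC 0.
Proof.
  intros Hk Hi.
  assert (HL : 0 < INR L) by (apply lt_0_INR; lia).
  destruct (Nat.eqb_spec k i) as [<-|Hne].
  - rewrite (Csum_ext L _ (fun _ => RtoC 1)); [rewrite Csum_const; ring|].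
    intros j _. rewrite Rminus_diag, Rmult_0_l. apply cis_0.
  - set (t := (INR k - INR i) * (2 * PI / INR L)).
    rewrite (Csum_ext L _ (fun j => cis t ^ j)%C).
    2: { intros j _. rewrite <- cis_mult. f_equal. unfold t, node. ring. }
    assert (Hq : (cis t ^ L)%C = RtoC 1).
    { rewrite <- cis_mult.
      (* [k - i] may be negative; moving [i] to the other factor keeps all multiples of [2 * PI]
         natural. *)
      assert (E : (cis (INR L * t) * cis (INR i * (2 * PI)))%C = cis (INR k * (2 * PI))).
      { rewrite <- cis_plus. f_equal. unfold t. field. lra. }
      rewrite !cis_2PI in E. rewrite <- E. ring. }
    assert (Hn : cis t <> RtoC 1).
    { pose proof PI_RGT_0 as HP.
      assert (Hd : 0 < 2 * PI / INR L) by (apply Rdiv_lt_0_compat; lra).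
      assert (E : 2 * PI = INR L * (2 * PI / INR L)) by (field; lra).
      assert (Hk' := lt_INR _ _ Hk). assert (Hi' := lt_INR _ _ Hi).
      assert (Hk0 := pos_INR k). assert (Hi0 := pos_INR i).
      apply cis_neq_1.
      - unfold t. set (d := 2 * PI / INR L) in *. rewrite E. split; nra.
      - unfold t. apply Rmult_integral_contrapositive_currified; [|lra].
        intros E0. apply Hne, INR_eq. lra. }
    assert (G := Csum_geometric L (cis t)). rewrite Hq in G.
    assert (Hm := Cminus_neq_0 _ _ Hn).
    match goal with |- ?S = _ =>
      replace S with (/ (cis t - RtoC 1) * ((cis t - RtoC 1) * S))%C by (field; auto) end.
    rewrite G. ring.
Qed.

Definition dirichlet (n : nat) (t : R) : C := Csum n (fun a => cis (INR a * t)).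

(** After expanding the kernel and exchanging the sums, orthogonality keeps only the frequency
    [k]. *)
Lemma dirichlet_interpolation (L k : nat) (t : R) : (k < L)%nat ->
  Csum L (fun j => cis (INR k * node L j) * dirichlet L (t - node L j))%C
  = (RtoC (INR L) * cis (INR k * t))%C.
Proof.
  intros Hk. unfold dirichlet.
  rewrite (Csum_ext L _ (fun j => Csum L (fun i =>
    cis (INR i * t) * cis ((INR k - INR i) * node L j))%C)).
  2: { intros j _. rewrite <- Csum_scal. apply Csum_ext. intros i _.
       rewrite <- !cis_plus. f_equal. ring. }
  rewrite Csum_exchange.
  rewrite (Csum_ext L _ (fun i => if Nat.eqb k i then (RtoC (INR L) * cis (INR i * t))%C else RtoC 0)).
  - apply (Csum_delta L k (fun i => RtoC (INR L) * cis (INR i * t))%C Hk).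
  - intros i Hi. rewrite Csum_scal, cis_orthogonality by auto.
    destruct (Nat.eqb k i); ring.
Qed.

(** Discrete Parseval: the [N] frequencies are distinct modulo [L], so only the diagonal of the
    expanded square survives. *)
Lemma dirichlet_L2 (N L : nat) (t : R) : (N <= L)%nat ->
  Rsum L (fun j => Cmod (dirichlet N (t - node L j)) ^ 2) = INR L * INR N.
Proof.
  intros HNL. apply RtoC_inj. rewrite RtoC_Rsum, RtoC_mult.
  rewrite (Csum_ext L _ (fun j => Csum N (fun a => Csum N (fun i =>
    cis ((INR a - INR i) * t) * cis ((INR i - INR a) * node L j))%C))).
  2: { intros j _. rewrite Cmod2_conj. unfold dirichlet. rewrite Cconj_Csum, Csum_mult.
       apply Csum_ext. intros a _. apply Csum_ext. intros i _.
       rewrite cis_conj, <- !cis_plus. f_equal. ring. }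
  rewrite Csum_exchange.
  rewrite (Csum_ext N _ (fun _ => RtoC (INR L))); [rewrite Csum_const; ring|].
  intros a Ha. rewrite Csum_exchange.
  rewrite (Csum_ext N _ (fun i => if Nat.eqb a i then RtoC (INR L) else RtoC 0)).
  - apply (Csum_delta N a (fun _ => RtoC (INR L)) Ha).
  - intros i Hi. rewrite Csum_scal, cis_orthogonality by lia. rewrite Nat.eqb_sym.
    destruct (Nat.eqb_spec a i) as [->|]; [|ring].
    rewrite Rminus_diag, Rmult_0_l, cis_0. ring.
Qed.

(** * Trigonometric polynomials and the substitution by the cosine *)

(** Trigonometric polynomials with frequencies from 0 to [B], given as a span: a linear identity
    then needs checking only on each [cis], with no handling of coefficients. *)
Inductive trig_span (B : nat) : (R -> C) -> Prop :=
| trig_cis l : (l <= B)%nat -> trig_span B (fun t => cis (INR l * t))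
| trig_plus S T : trig_span B S -> trig_span B T -> trig_span B (fun t => S t + T t)%C
| trig_scal a S : trig_span B S -> trig_span B (fun t => a * S t)%C.

Lemma trig_span_ext (B : nat) (S T : R -> C) :
  (forall t, S t = T t) -> trig_span B S -> trig_span B T.
Proof. intros E H. replace T with S; auto. apply functional_extensionality, E. Qed.

Lemma trig_span_sum (B n : nat) (S : nat -> R -> C) :
  (forall k, (k < n)%nat -> trig_span B (S k)) -> trig_span B (fun t => Csum n (fun k => S k t)).
Proof.
  induction n as [|n IH]; intros H; simpl.
  - apply trig_span_ext with (fun t => RtoC 0 * cis (INR 0 * t))%C; [intros; ring|].
    apply trig_scal, trig_cis. lia.
  - apply trig_plus; auto.
Qed.

(* Since [cis (l * _)] times [cis (a * _)] has frequency [l + a < N + 2 M], Dirichlet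
   interpolation at [N + 2 M] nodes applies for every [a < N]; the kernel is the
   average of the resulting formulas. *)
Lemma trig_reproducing (M N : nat) (S : R -> C) (t : R) : trig_span (2 * M) S ->
  let L := (N + 2 * M)%nat in
  Csum L (fun j => S (node L j) *
    (Cconj (dirichlet N (t - node L j)) * dirichlet L (t - node L j)))%C
  = (RtoC (INR L * INR N) * S t)%C.
Proof.
  intros H L. induction H as [l Hl | S T HS IHS HT IHT | a S HS IHS].
  - rewrite (Csum_ext L _ (fun j => Csum N (fun a => cis (- (INR a * t)) *
      (cis (INR (l + a) * node L j) * dirichlet L (t - node L j))))%C).
    2: { intros j _. unfold dirichlet at 1. rewrite Cconj_Csum.
         rewrite (Cmult_comm (Csum _ _)), Cmult_assoc, (Cmult_comm _ (Csum N _)), Cmult_comm,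
           <- !Csum_scal. apply Csum_ext. intros a _.
         rewrite cis_conj, plus_INR.
         replace ((INR l + INR a) * node L j)
           with (INR l * node L j + (- (INR a * (t - node L j)) + INR a * t)) by ring.
         rewrite !cis_plus.
         assert (E : (cis (- (INR a * t)) * cis (INR a * t))%C = RtoC 1).
         { rewrite <- cis_plus, Rplus_opp_l. apply cis_0. }
         match goal with |- (?A = ?B * (?X * (?Y * ?Z) * ?W))%C =>
           replace (B * (X * (Y * Z) * W))%C with (B * Z * (X * Y * W))%C by ring end.
         rewrite E. ring. }
    rewrite Csum_exchange.
    rewrite (Csum_ext N _ (fun _ => RtoC (INR L) * cis (INR l * t))%C).
    + rewrite Csum_const, RtoC_mult. ring.
    + intros a Ha. rewrite Csum_scal, dirichlet_interpolation by (unfold L; lia).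
      rewrite plus_INR.
      replace (INR l * t) with (- (INR a * t) + (INR l + INR a) * t) by ring.
      rewrite (cis_plus (- _)). ring.
  - rewrite Cmult_plus_distr_l, <- IHS, <- IHT, <- Csum_plus.
    apply Csum_ext. intros j _. ring.
  - match goal with |- _ = (?A * (?B * ?D))%C => replace (A * (B * D))%C with (B * (A * D))%C by ring end.
    rewrite <- IHS, <- Csum_scal. apply Csum_ext. intros j _. ring.
Qed.

(** The discrete L1 norm of the unnormalised kernel is at most [(L N + L^2) / 2]. Divided by [L N]
    this is [(1 + L / N) / 2], which equals [1 + M / N] as [L = N + 2 M]. *)
Lemma trig_norming (M N : nat) (S : R -> C) (mu t : R) :
  (0 < N)%nat -> trig_span (2 * M) S ->
  let L := (N + 2 * M)%nat in
  (forall j, (j < L)%nat -> Cmod (S (node L j)) <= mu) ->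
  Cmod (S t) <= (1 + INR M / INR N) * mu.
Proof.
  intros HN HS L Hmu.
  assert (HN' : 0 < INR N) by (apply lt_0_INR; lia).
  assert (HL' : 0 < INR L) by (apply lt_0_INR; unfold L; lia).
  assert (Hmu0 : 0 <= mu).
  { eapply Rle_trans; [apply Cmod_ge_0 | apply (Hmu 0%nat); unfold L; lia]. }
  assert (E := f_equal Cmod (trig_reproducing M N S t HS)). fold L in E.
  rewrite Cmod_mult, Cmod_R, Rabs_pos_eq in E by nra.
  assert (B : INR L * INR N * Cmod (S t) <= mu / 2 * (INR L * INR N + INR L * INR L)).
  { rewrite <- E. eapply Rle_trans; [apply Cmod_Csum|].
    rewrite <- (dirichlet_L2 N L t), <- (dirichlet_L2 L L t) by (unfold L; lia).
    rewrite <- Rsum_lin. apply Rsum_le. intros j Hj.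
    rewrite !Cmod_mult, Cmod_conj.
    set (x := Cmod (dirichlet N (t - node L j))). set (y := Cmod (dirichlet L (t - node L j))).
    assert (0 <= x) by apply Cmod_ge_0. assert (0 <= y) by apply Cmod_ge_0.
    apply Rle_trans with (mu * (x * y)); [apply Rmult_le_compat_r; [nra | auto]|].
    (* AM-GM: [x * y <= (x^2 + y^2) / 2] *)
    assert (0 <= mu * (x - y) ^ 2) by (apply Rmult_le_pos; [auto | apply pow2_ge_0]). nra. }
  assert (EL : INR L = INR N + 2 * INR M).
  { unfold L. rewrite plus_INR, mult_INR. simpl. ring. }
  apply (Rmult_le_reg_l (INR L * INR N)); [nra|].
  eapply Rle_trans; [exact B|]. apply Req_le. rewrite EL. field. lra.
Qed.

(** The powers of the cosine have frequencies between [-M] and [M]; the factor [cis (INR M * t)]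
    shifts them to the range from 0 to [2 * M]. The induction rests on
    [cis t * cos t = (cis (2 t) + 1) / 2]. *)
Lemma trig_span_cos_pow (M k : nat) : (k <= M)%nat ->
  trig_span (2 * M) (fun t => cis (INR M * t) * RtoC (cos t) ^ k)%C.
Proof.
  revert M. induction k as [|k IH]; intros M Hk.
  - apply trig_span_ext with (fun t => cis (INR M * t)); [intros; simpl; ring|].
    apply trig_cis. lia.
  - destruct M as [|M]; [lia|].
    assert (Hs : forall S, trig_span (2 * M) S ->
      trig_span (2 * Datatypes.S M) (fun t => (cis (INR 2 * t) + RtoC 1) * S t)%C).
    { intros S HS. induction HS as [l Hl | S T HS IHS HT IHT | a S HS IHS].
      - apply trig_span_ext with (fun t => cis (INR (2 + l) * t) + cis (INR l * t))%C.
        + intros t. rewrite plus_INR, Rmult_plus_distr_r, cis_plus. ring.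
        + apply trig_plus; apply trig_cis; lia.
      - eapply trig_span_ext; [|apply trig_plus; [exact IHS | exact IHT]]. intros; simpl; ring.
      - eapply trig_span_ext; [|apply (trig_scal _ a); exact IHS]. intros; simpl; ring. }
    eapply trig_span_ext; [|apply (trig_scal _ (RtoC (/ 2))), Hs, (IH M); lia].
    intros t. cbv beta.
    assert (E : (RtoC (/ 2) * (cis (INR 2 * t) + RtoC 1) = cis t * RtoC (cos t))%C).
    { replace (INR 2 * t) with (2 * t) by (simpl; ring).
      unfold cis, Cmult, Cplus, RtoC; simpl. rewrite cos_2a_cos, sin_2a. f_equal; field. }
    rewrite Cpow_S, (S_INR M), (Rmult_plus_distr_r (INR M)), (cis_plus (INR M * t)), Rmult_1_l.
    match goal with |- (?A * (?B * (?D * ?F)) = _)%C =>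
      replace (A * (B * (D * F)))%C with ((A * B) * (D * F))%C by ring end.
    rewrite E. ring.
Qed.

(** With [x = b cos t], the polynomial times the unimodular factor [cis (INR M * t)] lies in
    [trig_span (2 * M)], and its modulus is unchanged. *)
Lemma polynomial_norming (b : R) (M N : nat) (c : nat -> C) (mu x : R) :
  0 < b -> (0 < N)%nat ->
  let L := (N + 2 * M)%nat in
  let P := fun x => Csum M (fun k => c k * RtoC x ^ k)%C in
  (forall j, (j < L)%nat -> Cmod (P (b * cos (node L j))) <= mu) ->
  Rabs x <= b -> Cmod (P x) <= (1 + INR M / INR N) * mu.
Proof.
  intros Hb HN L P Hmu Hx. apply Rabs_le_between in Hx.
  set (S := fun t => (cis (INR M * t) * P (b * cos t)%R)%C).
  assert (HSP : forall t, Cmod (S t) = Cmod (P (b * cos t))).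
  { intros t. unfold S. rewrite Cmod_mult, Cmod_cis. ring. }
  assert (Hx' : b * cos (acos (x / b)) = x).
  { rewrite cos_acos; [field; lra|].
    split; apply (Rmult_le_reg_r b); try lra; unfold Rdiv; rewrite Rmult_assoc, Rinv_l; lra. }
  rewrite <- Hx', <- HSP. apply trig_norming; auto.
  - apply trig_span_ext with
      (fun t => Csum M (fun k => (c k * RtoC b ^ k) * (cis (INR M * t) * RtoC (cos t) ^ k))%C).
    + intros t. unfold S, P. rewrite <- Csum_scal. apply Csum_ext. intros k _.
      rewrite RtoC_mult, Cpow_mult_l. ring.
    + apply (trig_span_sum (2 * M) M
        (fun k t => (c k * RtoC b ^ k) * (cis (INR M * t) * RtoC (cos t) ^ k))%C).
      intros k Hk. apply trig_scal, trig_span_cos_pow. lia.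
  - intros j Hj. fold L. rewrite HSP. apply Hmu, Hj.
Qed.

(** * Product grids *)

(** The nodes run over a full turn, so the indices [j] and [L - j] give the same point; only the
    length of the list matters for the count. *)
Definition cheb_points (b : R) (L : nat) : list R :=
  map (fun j => b * cos (node L j)) (seq 0 L).

Lemma cheb_points_bound (b : R) (L : nat) (p : R) :
  0 < b -> In p (cheb_points b L) -> Rabs p <= b.
Proof.
  intros Hb Hp. apply in_map_iff in Hp as (j & <- & _).
  pose proof (COS_bound (node L j)). apply Rabs_le. nra.
Qed.

(** The Taylor error enters twice: at the nodes, where norming multiplies it by [q], and once more
    at [x]. Hence the factor [1 + q]. *)
Lemma entire_norming (g : C -> C) (b G mu x : R) (M N : nat) :
  0 < b -> (0 < N)%nat -> (forall z, Cdiff g z) ->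
  on_edges (fun z => Cmod (g z) <= G) (- (2 * b)) (2 * b) (- (2 * b)) (2 * b) ->
  (forall p, In p (cheb_points b (N + 2 * M)) -> Cmod (g (RtoC p)) <= mu) ->
  Rabs x <= b ->
  let q := 1 + INR M / INR N in
  Cmod (g (RtoC x)) <= q * mu + (1 + q) * (32 * G * (/ 2) ^ M).
Proof.
  intros Hb HN Hg HG Hmu Hx q.
  destruct (Cauchy_Taylor g b G M Hb Hg HG) as [c Hc].
  set (e := 32 * G * (/ 2) ^ M) in *.
  set (P := fun x => Csum M (fun k => c k * RtoC x ^ k)%C).
  assert (HP : Cmod (P x) <= q * (mu + e)).
  { apply (polynomial_norming b M N c (mu + e) x Hb HN); auto.
    intros j Hj. fold (P (b * cos (node (N + 2 * M) j))).
    set (p := b * cos (node (N + 2 * M) j)).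
    assert (Hp : In p (cheb_points b (N + 2 * M))).
    { apply in_map_iff. exists j. split; auto. apply in_seq. lia. }
    assert (Hpb := cheb_points_bound _ _ _ Hb Hp).
    specialize (Hmu p Hp). specialize (Hc p Hpb). fold (P p) in Hc.
    replace (P p) with (g (RtoC p) + - (g (RtoC p) - P p))%C by ring.
    eapply Rle_trans; [apply Cmod_triangle|]. rewrite Cmod_opp. lra. }
  specialize (Hc x Hx). fold (P x) in Hc.
  replace (g (RtoC x)) with ((g (RtoC x) - P x) + P x)%C by ring.
  eapply Rle_trans; [apply Cmod_triangle|]. lra.
Qed.

Definition fcons {m : nat} (p : R) (x : Fin.t m -> R) : Fin.t (S m) -> R :=
  fun i => Fin.caseS' i (fun _ => R) p x.

Definition updR {m : nat} (x : Fin.t m -> R) (j : Fin.t m) (p : R) : Fin.t m -> R :=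
  fun i => if Fin.eq_dec i j then p else x i.

Lemma fcons_eta {m : nat} (x : Fin.t (S m) -> R) :
  x = fcons (x Fin.F1) (fun i => x (Fin.FS i)).
Proof.
  apply functional_extensionality. intros i. apply (Fin.caseS' i); reflexivity.
Qed.

Lemma updR_fcons_F1 {m : nat} (p r : R) (x : Fin.t m -> R) :
  updR (fcons p x) Fin.F1 r = fcons r x.
Proof.
  apply functional_extensionality. intros i. unfold updR. apply (Fin.caseS' i).
  - destruct (Fin.eq_dec Fin.F1 Fin.F1); simpl; congruence.
  - intros k. destruct (Fin.eq_dec (Fin.FS k) Fin.F1) as [E|E]; [discriminate|reflexivity].
Qed.

Lemma updR_fcons_FS {m : nat} (p r : R) (x : Fin.t m -> R) (j : Fin.t m) :
  updR (fcons p x) (Fin.FS j) r = fcons p (updR x j r).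
Proof.
  apply functional_extensionality. intros i. unfold updR. apply (Fin.caseS' i).
  - destruct (Fin.eq_dec Fin.F1 (Fin.FS j)); simpl; congruence.
  - intros k. simpl. destruct (Fin.eq_dec (Fin.FS k) (Fin.FS j)) as [E|E],
      (Fin.eq_dec k j) as [E'|E']; auto.
    + apply Fin.FS_inj in E. contradiction.
    + subst. contradiction.
Qed.

Lemma inQ_fcons {m : nat} (b p : R) (x : Fin.t m -> R) :
  Rabs p <= b -> inQ b x -> inQ b (fcons p x).
Proof. intros Hp Hx i. apply (Fin.caseS' i); simpl; auto. Qed.

Fixpoint grid (pts : list R) (m : nat) : list (Fin.t m -> R) :=
  match m with
  | O => (fun _ => 0) :: nil
  | S k => flat_map (fun p => map (fcons p) (grid pts k)) pts
  end.

Lemma grid_length (pts : list R) (m : nat) : length (grid pts m) = (length pts ^ m)%nat.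
Proof.
  induction m as [|m IH]; simpl; auto.
  rewrite (flat_map_constant_length (c := (length pts ^ m)%nat)); [lia|].
  intros p _. rewrite length_map. auto.
Qed.

Lemma grid_inQ (pts : list R) (b : R) (m : nat) (x : Fin.t m -> R) :
  0 <= b -> (forall p, In p pts -> Rabs p <= b) -> In x (grid pts m) -> inQ b x.
Proof.
  intros Hb Hp. revert x. induction m as [|m IH]; simpl; intros x Hx.
  - destruct Hx as [<-|[]]. intros i. rewrite Rabs_R0. auto.
  - apply in_flat_map in Hx as (p & Hin & Hx). apply in_map_iff in Hx as (y & <- & Hy).
    apply inQ_fcons; auto.
Qed.

(** Induction on the dimension: the one-variable estimate treats the first coordinate, the induction
    hypothesis the others with the first fixed at a node. [F] is an arbitrary real function so that
    the induction can be applied to its slices. *)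
Lemma grid_norming (pts : list R) (b q delta mu : R) (m : nat) (F : (Fin.t m -> R) -> R) :
  1 <= q -> 0 <= delta -> (forall p, In p pts -> Rabs p <= b) ->
  (forall x j nu, inQ b x -> (forall p, In p pts -> F (updR x j p) <= nu) ->
     F x <= q * nu + delta) ->
  (forall x, In x (grid pts m) -> F x <= mu) ->
  forall x, inQ b x -> F x <= q ^ m * (mu + INR m * delta).
Proof.
  intros Hq Hd Hp. revert F. induction m as [|m IH]; intros F HF Hg x Hx.
  - simpl. replace x with (fun _ : Fin.t 0 => 0); [specialize (Hg _ (or_introl eq_refl)); simpl in Hg; lra|].
    apply functional_extensionality. intros i. apply (Fin.case0 (fun i => 0 = x i) i).
  - rewrite (fcons_eta x).
    set (x0 := x Fin.F1). set (x' := fun i => x (Fin.FS i)).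
    assert (Hx' : inQ b x') by (intros i; apply Hx).
    assert (Hx0 : Rabs x0 <= b) by apply Hx.
    eapply Rle_trans; [apply (HF _ Fin.F1 (q ^ m * (mu + INR m * delta)))|].
    + apply inQ_fcons; auto.
    + intros p Hin. rewrite updR_fcons_F1.
      apply (IH (fun y => F (fcons p y))); auto.
      * intros y j nu Hy Hnu. apply (HF _ (Fin.FS j)).
        -- apply inQ_fcons; auto.
        -- intros r Hr. rewrite updR_fcons_FS. auto.
      * intros y Hy. apply Hg. simpl. apply in_flat_map. exists p. split; auto.
        apply in_map; auto.
    (* The new error [delta] is enlarged to [q ^ (m + 1) * delta], which gives the uniform shape of
       the bound. *)
    + rewrite S_INR. simpl. assert (1 <= q ^ m) by (apply pow_R1_Rle; auto).
      assert (1 <= q * q ^ m) by nra. nra.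
Qed.

(** * Entire functions of several variables and sup norms on the cube *)

Lemma upd_upd {m : nat} (w : Fin.t m -> C) (j : Fin.t m) (y z : C) :
  upd (upd w j y) j z = upd w j z.
Proof.
  apply functional_extensionality. intros i. unfold upd. destruct (Fin.eq_dec i j); auto.
Qed.

Lemma upd_same {m : nat} (w : Fin.t m -> C) (j : Fin.t m) (z : C) : upd w j z j = z.
Proof. unfold upd. destruct (Fin.eq_dec j j); congruence. Qed.

Lemma toC_updR {m : nat} (x : Fin.t m -> R) (j : Fin.t m) (p : R) :
  toC (updR x j p) = upd (toC x) j (RtoC p).
Proof.
  apply functional_extensionality. intros i. unfold toC, updR, upd.
  destruct (Fin.eq_dec i j); auto.
Qed.

Lemma updR_id {m : nat} (x : Fin.t m -> R) (j : Fin.t m) : updR x j (x j) = x.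
Proof.
  apply functional_extensionality. intros i. unfold updR. destruct (Fin.eq_dec i j); congruence.
Qed.

(** [entire] speaks of the derivative at the current coordinate [w j] only; using it at the point
    [upd w j z] reaches every [z]. *)
Lemma entire_Cdiff {m : nat} (f : (Fin.t m -> C) -> C) (w : Fin.t m -> C) (j : Fin.t m) (z : C) :
  entire f -> Cdiff (fun y => f (upd w j y)) z.
Proof.
  intros [_ Hf]. apply ex_derive_Cdiff.
  assert (H := Hf (upd w j z) j). rewrite upd_same in H.
  replace (fun y => f (upd w j y)) with (fun y => f (upd (upd w j z) j y)); auto.
  apply functional_extensionality. intros y. rewrite upd_upd. reflexivity.
Qed.

Lemma sumFin_le (m : nat) (g : Fin.t m -> R) (K : R) :
  (forall i, g i <= K) -> sumFin m g <= INR m * K.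
Proof.
  induction m as [|m IH]; intros H; [simpl; lra|]. rewrite S_INR. simpl.
  specialize (IH (fun i => g (Fin.FS i)) (fun i => H (Fin.FS i))). specialize (H Fin.F1). lra.
Qed.

(** [real] is meaningful only for a finite supremum: the bound [B] excludes plus infinity, and the
    value at the origin excludes minus infinity. *)
Lemma supQ_le {m : nat} (b B : R) (f : (Fin.t m -> C) -> C) : 0 <= b ->
  (forall x, inQ b x -> Cmod (f (toC x)) <= B) -> supQ b f <= B.
Proof.
  intros Hb H. unfold supQ.
  set (E := fun r => exists x, inQ b x /\ r = Cmod (f (toC x))).
  destruct (Lub_Rbar_correct E) as [Hub Hlub].
  assert (H0 : E (Cmod (f (toC (fun _ => 0))))).
  { exists (fun _ => 0). split; auto. intros i. rewrite Rabs_R0. auto. }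
  assert (Hle : Rbar_le (Lub_Rbar E) B).
  { apply Hlub. intros r [x [Hx ->]]. apply H, Hx. }
  specialize (Hub _ H0). destruct (Lub_Rbar E); simpl in *; auto; contradiction.
Qed.

Lemma supQ_ge_0 {m : nat} (b : R) (f : (Fin.t m -> C) -> C) : 0 <= b -> 0 <= supQ b f.
Proof.
  intros Hb. unfold supQ.
  set (E := fun r => exists x, inQ b x /\ r = Cmod (f (toC x))).
  destruct (Lub_Rbar_correct E) as [Hub _].
  assert (H0 : E (Cmod (f (toC (fun _ => 0))))).
  { exists (fun _ => 0). split; auto. intros i. rewrite Rabs_R0. auto. }
  specialize (Hub _ H0). pose proof (Cmod_ge_0 (f (toC (fun _ => 0)))).
  destruct (Lub_Rbar E); simpl in *; lra.
Qed.

Lemma maxpts_ge {m : nat} (f : (Fin.t m -> C) -> C) (X : list (Fin.t m -> R)) (x : Fin.t m -> R) :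
  In x X -> Cmod (f (toC x)) <= maxpts f X.
Proof.
  unfold maxpts. induction X as [|y X IH]; simpl; [tauto|]. intros [<-|H].
  - apply Rmax_l.
  - eapply Rle_trans; [apply IH, H | apply Rmax_r].
Qed.

(** Serves to make [tau] positive. A negative finite supremum would mean an empty set, for which no
    least upper bound is finite; [real] sends the infinite values to 0. *)
Lemma gamma0_ge_0 : 0 <= gamma0.
Proof.
  unfold gamma0. set (E := fun t => 0 < t /\ 0 <= psi t).
  destruct (Lub_Rbar_correct E) as [Hub Hlub].
  destruct (Lub_Rbar E) as [l| |]; simpl; try lra.
  destruct (Rle_dec 0 l) as [|Hl]; auto.
  assert (K : Rbar_le l (l - 1)).
  { apply Hlub. intros t Ht. specialize (Hub t Ht). destruct Ht. simpl in *. lra. }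
  simpl in K. lra.
Qed.

Lemma exp_le_compat (x y : R) : x <= y -> exp x <= exp y.
Proof.
  intros [H | ->]; [left; apply exp_increasing, H | apply Rle_refl].
Qed.

Lemma exp_pow_INR (x : R) (n : nat) : exp x ^ n = exp (INR n * x).
Proof.
  induction n as [|n IH]; [simpl; rewrite Rmult_0_l, exp_0; reflexivity|].
  rewrite S_INR, Rmult_plus_distr_r, exp_plus, <- IH, Rmult_1_l. simpl. ring.
Qed.

Lemma norming_grid_entire (m : nat) (b A s : R) (M N : nat) (f : (Fin.t m -> C) -> C) :
  0 < b -> 0 <= A -> 0 <= s -> (0 < N)%nat -> entire f ->
  (forall w, Cmod (f w) <= A * supQ b f * exp (s * sumFin m (fun j => Cmod (w j)))) ->
  let q := 1 + INR M / INR N in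
  let kappa := (1 + q) * (32 * (A * exp (s * (INR m * (4 * b)))) * (/ 2) ^ M) in
  supQ b f <= q ^ m * (maxpts f (grid (cheb_points b (N + 2 * M)) m)
                       + INR m * (kappa * supQ b f)).
Proof.
  intros Hb HA Hs HN Hf Hgrow q kappa.
  set (pts := cheb_points b (N + 2 * M)).
  assert (HS := supQ_ge_0 b f (Rlt_le _ _ Hb)).
  assert (Hq : 1 <= q).
  { unfold q. assert (0 <= INR M / INR N); [|lra].
    apply Rmult_le_pos; [apply pos_INR | left; apply Rinv_0_lt_compat, lt_0_INR; lia]. }
  assert (Hpts : forall p, In p pts -> Rabs p <= b) by (intros p; apply cheb_points_bound, Hb).
  assert (Hk : 0 <= kappa).
  { unfold kappa. repeat apply Rmult_le_pos; try lra; [left; apply exp_pos | apply pow_le; lra]. }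
  apply supQ_le; [lra|].
  apply (grid_norming pts b q (kappa * supQ b f) _ m (fun x => Cmod (f (toC x)))); auto.
  - apply Rmult_le_pos; auto.
  - intros x j nu Hx Hnu.
    assert (E := entire_norming (fun z => f (upd (toC x) j z)) b
      (A * supQ b f * exp (s * (INR m * (4 * b)))) nu (x j) M N Hb HN).
    cbv beta in E. rewrite <- toC_updR, updR_id in E.
    eapply Rle_trans; [apply E|].
    + intros z. apply entire_Cdiff, Hf.
    + assert (Hz : forall u v, Rabs u <= 2 * b -> Rabs v <= 2 * b ->
        Cmod (f (upd (toC x) j (u, v))) <= A * supQ b f * exp (s * (INR m * (4 * b)))).
      { intros u v Hu Hv. eapply Rle_trans; [apply Hgrow|].
        apply Rmult_le_compat_l; [apply Rmult_le_pos; auto|].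
        apply exp_le_compat, Rmult_le_compat_l; auto. apply sumFin_le. intros i.
        unfold upd. destruct (Fin.eq_dec i j).
        - eapply Rle_trans; [apply Cmod_le_abs|]. simpl. lra.
        - unfold toC. rewrite Cmod_R. specialize (Hx i). lra. }
      split; intros t Ht; split; apply Hz; apply Rabs_le; lra.
    + intros p Hp. rewrite <- toC_updR. apply Hnu, Hp.
    + apply Hx.
    + fold q. apply Req_le. unfold kappa. ring.
  - intros x Hx. apply maxpts_ge, Hx.
Qed.

(** * Choice of the constants and conclusion *)

(** From [1 + y <= exp y], the power is at most [exp (m / A)]; [m + 1] in the choice of [A] avoids
    dividing by zero. *)
Lemma pow_one_plus_inv_small (m : nat) (e : R) : 0 < e ->
  exists A, (0 < A)%nat /\ (1 + / INR A) ^ m <= 1 + e.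
Proof.
  intros He. assert (Hl : 0 < ln (1 + e)) by (rewrite <- ln_1; apply ln_increasing; lra).
  assert (Hm := pos_INR m).
  destruct (archimed_cor1 (ln (1 + e) / (INR m + 1))) as (A & HA & HA0);
    [apply Rdiv_lt_0_compat; lra|].
  exists A. split; auto.
  assert (Hi : 0 < / INR A) by (apply Rinv_0_lt_compat, lt_0_INR, HA0).
  apply Rle_trans with (exp (/ INR A) ^ m).
  - apply pow_incr. split; [lra | apply exp_ineq1_le].
  - rewrite exp_pow_INR. rewrite <- (exp_ln (1 + e)) by lra. apply exp_le_compat.
    assert (E : ln (1 + e) = (INR m + 1) * (ln (1 + e) / (INR m + 1))) by (field; lra).
    rewrite E. nra.
Qed.

Theorem theoremT1p3 (m : nat) (b tau : R) (nseq : nat -> nat) (D : nat -> R) :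
  (1 <= m)%nat -> 0 < b -> gamma0 < tau ->
  (forall N, (0 < nseq N)%nat) ->
  (forall N, (nseq N < nseq (S N))%nat) ->
  (forall N, 0 < D (nseq N)) ->
  is_lim_seq (fun N => D (nseq N) * exp (INR (nseq N) * psi tau)) 0 ->
  forall gamma : R, 0 < gamma ->
  exists (K : R) (n0 : nat),
    forall N : nat, (n0 <= nseq N)%nat ->
      let n := nseq N in
      let sigma := INR n / (INR m * b * tau) in
      exists X : list (Fin.t m -> R),
        X <> nil /\
        (forall x, In x X -> inQ b x) /\
        INR (length X) <= K * INR n ^ m /\
        forall f : (Fin.t m -> C) -> C,
          entire f ->
          (forall w : Fin.t m -> C,
             Cmod (f w) <= D n * supQ b f * exp (sigma * sumFin m (fun j => Cmod (w j)))) ->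
          supQ b f <= (1 + gamma) * maxpts f X.
Proof.
  intros Hm Hb Htau Hpos Hinc HD Hlim gamma Hgamma.
  assert (Ht : 0 < tau) by (pose proof gamma0_ge_0; lra).
  assert (Hm' : 0 < INR m) by (apply lt_0_INR; lia).
  (* Half of [gamma] pays for [q ^ m], the other half for the approximation error. *)
  destruct (pow_one_plus_inv_small m (gamma / 2)) as (A & HA & HqA); [lra|].
  assert (HA' : 0 < INR A) by (apply lt_0_INR; lia).
  set (q := 1 + / INR A) in *.
  assert (Hq : 1 <= q) by (unfold q; assert (0 < / INR A) by (apply Rinv_0_lt_compat; lra); lra).
  assert (Hqm : 1 <= q ^ m) by (apply pow_R1_Rle; auto).
  (* Chosen so that [exp (- n psi) * exp (4 n / tau) * exp (- c n) = exp (- n)]. *)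
  set (c := 1 + 4 / tau - psi tau).
  destruct (halving_small 1 (exp (- c)) (exp_pos _)) as [B0 HB0].
  rewrite Rabs_R1, Rmult_1_l in HB0.
  (* The successor makes [B], and hence [M], positive. *)
  set (B := S B0).
  assert (HB : (/ 2) ^ B <= exp (- c)).
  { unfold B. simpl. assert (0 < (/ 2) ^ B0) by (apply pow_lt; lra). lra. }
  set (Cst := q ^ m * INR m * ((1 + q) * 32)).
  assert (HCst : 0 < Cst) by (unfold Cst; repeat apply Rmult_lt_0_compat; lra).
  (* The solution of [(1 + gamma) * (1 - eta) = 1 + gamma / 2]. *)
  set (eta := gamma / 2 / (1 + gamma)).
  assert (Heta : 0 < eta) by (unfold eta; repeat apply Rdiv_lt_0_compat; lra).
  destruct (INR_unbounded (Cst / eta)) as [n1 Hn1].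
  assert (Hev : exists N0, forall N, (N0 <= N)%nat ->
    D (nseq N) * exp (INR (nseq N) * psi tau) <= 1).
  { apply is_lim_seq_spec in Hlim. destruct (Hlim (mkposreal 1 Rlt_0_1)) as [N0 HN0].
    exists N0. intros N HN. specialize (HN0 N HN). simpl in HN0.
    apply Rabs_lt_between in HN0. lra. }
  destruct Hev as [N0 HN0].
  (* Translates the threshold [nseq N0 <= nseq N] on the values back into [N0 <= N] on the
     indices. *)
  assert (Hmono : forall N k, (nseq N + k <= nseq (N + k))%nat).
  { intros N k. induction k as [|k IH]; [rewrite !Nat.add_0_r; lia|].
    rewrite !Nat.add_succ_r. specialize (Hinc (N + k)%nat). lia. }
  (* Each coordinate gets [P + 2 * M = (A + 2) * B * n] nodes. *)
  exists (INR ((A + 2) * B) ^ m), (Nat.max n1 (nseq N0)).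
  intros N HN n sigma.
  assert (HNN0 : (N0 <= N)%nat).
  { destruct (Nat.le_gt_cases N0 N); auto. specialize (Hmono N (N0 - N)%nat).
    replace (N + (N0 - N))%nat with N0 in Hmono by lia. lia. }
  specialize (HN0 N HNN0). fold n in HN0.
  assert (Hn : (0 < n)%nat) by apply Hpos.
  assert (Hn' : 0 < INR n) by (apply lt_0_INR, Hn).
  set (M := (B * n)%nat). set (P := (A * M)%nat).
  assert (HM : (0 < M)%nat) by (unfold M, B; nia).
  assert (HP : (0 < P)%nat) by (unfold P; nia).
  assert (HqE : 1 + INR M / INR P = q).
  { assert (0 < INR M) by apply lt_0_INR, HM.
    unfold q, P. rewrite mult_INR. field. lra. }
  set (L := (P + 2 * M)%nat).
  exists (grid (cheb_points b L) m).
  assert (Hlen : length (grid (cheb_points b L) m) = (L ^ m)%nat).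
  { rewrite grid_length. unfold cheb_points. rewrite length_map, length_seq. reflexivity. }
  split; [|split; [|split]].
  - intros E. rewrite E in Hlen. simpl in Hlen.
    assert (L ^ m <> 0)%nat by (apply Nat.pow_nonzero; unfold L; lia). lia.
  - intros x Hx. apply (grid_inQ (cheb_points b L)); auto; [lra|].
    intros p Hp. apply (cheb_points_bound b L); auto.
  - rewrite Hlen, pow_INR, <- Rpow_mult_distr, <- mult_INR. apply Req_le. f_equal. f_equal.
    unfold L, P, M. ring.
  - intros f Hf Hgrow.
    assert (Hs : 0 <= sigma).
    { unfold sigma. left. apply Rdiv_lt_0_compat; auto. repeat apply Rmult_lt_0_compat; auto. }
    assert (HDn : 0 < D n) by apply HD.
    assert (Key := norming_grid_entire m b (D n) sigma M P f Hb (Rlt_le _ _ HDn) Hs HP Hf Hgrow).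
    cbv zeta in Key. rewrite HqE in Key. fold L in Key.
    set (mx := maxpts f (grid (cheb_points b L) m)) in *.
    assert (HS := supQ_ge_0 b f (Rlt_le _ _ Hb)). set (S := supQ b f) in *.
    replace (sigma * (INR m * (4 * b))) with (INR n * (4 / tau)) in Key
      by (unfold sigma; field; lra).
    assert (Hsmall : D n * exp (INR n * (4 / tau)) * (/ 2) ^ M <= exp (- INR n)).
    { assert (E1 : (/ 2) ^ M <= exp (- c) ^ n).
      { unfold M. rewrite pow_mult. apply pow_incr. split; auto. apply pow_le; lra. }
      rewrite exp_pow_INR in E1.
      assert (E2 : D n <= exp (- (INR n * psi tau))).
      { apply (Rmult_le_reg_r (exp (INR n * psi tau))); [apply exp_pos|].
        rewrite <- exp_plus, Rplus_opp_l, exp_0. exact HN0. }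
      apply Rle_trans with (exp (- (INR n * psi tau)) * exp (INR n * (4 / tau)) * exp (INR n * - c)).
      - apply Rmult_le_compat; auto.
        + apply Rmult_le_pos; [lra | left; apply exp_pos].
        + apply pow_le; lra.
        + apply Rmult_le_compat_r; auto. left; apply exp_pos.
      - rewrite <- !exp_plus. apply Req_le. f_equal. unfold c. ring. }
    (* Uses [exp n >= 1 + n] and [n >= n1 > Cst / eta]. *)
    assert (Hexp : Cst * exp (- INR n) <= eta).
    { rewrite exp_Ropp. apply (Rmult_le_reg_r (exp (INR n))); [apply exp_pos|].
      rewrite Rmult_assoc, Rinv_l by (apply Rgt_not_eq, exp_pos).
      pose proof (exp_ineq1_le (INR n)) as X1.
      assert (X2 : INR n1 <= INR n) by (apply le_INR; lia).
      assert (X3 : Cst = eta * (Cst / eta)) by (field; lra).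
      rewrite Rmult_1_r, X3. apply Rmult_le_compat_l; lra. }
    (* As [eta < 1], the term [eta * S] can be moved to the left. *)
    assert (HKS : S <= q ^ m * mx + eta * S).
    { eapply Rle_trans; [exact Key|].
      set (r := D n * exp (INR n * (4 / tau)) * (/ 2) ^ M) in *.
      replace (q ^ m * (mx + INR m * ((1 + q) * (32 * (D n * exp (INR n * (4 / tau))) * (/ 2) ^ M) * S)))
        with (q ^ m * mx + Cst * r * S) by (unfold Cst, r; ring).
      apply Rplus_le_compat_l, Rmult_le_compat_r; auto.
      eapply Rle_trans; [|exact Hexp]. apply Rmult_le_compat_l; lra. }
    assert (Hmx : 0 <= mx).
    { unfold mx, maxpts. generalize (grid (cheb_points b L) m). intros l. destruct l as [|y l]; simpl; [lra|].
      eapply Rle_trans; [apply Cmod_ge_0 | apply Rmax_l]. }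
    assert (E1 : (1 + gamma) * (1 - eta) = 1 + gamma / 2) by (unfold eta; field; lra).
    assert (E2 : S * (1 - eta) <= (1 + gamma / 2) * mx) by nra.
    assert (E3 : 0 < 1 - eta).
    { apply (Rmult_lt_reg_l (1 + gamma)); lra. }
    apply (Rmult_le_reg_r (1 - eta)); auto.
    replace ((1 + gamma) * mx * (1 - eta)) with ((1 + gamma) * (1 - eta) * mx) by ring.
    rewrite E1. exact E2.
Qed.
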